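(* Let $p\in[1,\infty)$, $N\in\mathbb{N}$, and let $\{\rho_\varepsilon\}_{\varepsilon>0}$ be a family of non-negative measurable kernels $\rho_\varepsilon:\mathbb{R}^N\to[0,\infty)$. The following three conditions are equivalent. (1) (Uniform moment conditions) For every fixed $R>0$, $$\lim_{\varepsilon\to0}\int_{|z|>R}\rho_\varepsilon(z)\,dz=1\quad\text{and}\quad \lim_{\varepsilon\to0}\int_{|z|<R}|z|^p\rho_\varepsilon(z)\,dz=0.$$ (2) (Iterated limits conditions) Taking limits in the order first $\varepsilon\to0$, then $R\to\infty$, $$\lim_{R\to\infty}\lim_{\varepsilon\to0}\int_{|z|>R}\rho_\varepsilon(z)\,dz=1\quad\text{and}\quad \lim_{R\to\infty}\lim_{\varepsilon\to0}\int_{|z|<R}|z|^p\rho_\varepsilon(z)\,dz=0.$$ (3) (Maz'ya--Shaposhnikova formula) For every $u\in C_c^\infty(\mathbb{R}^N)$, $\mathcal{F}_\varepsilon(u)$ is well-defined for $\varepsilon>0$ sufficiently small, and $$\lim_{\varepsilon\to0}\mathcal{F}_\varepsilon(u)=2\|u\|_{L^p(\mathbb{R}^N)}^p;$$ moreover, for each such $u$ and each fixed $R>0$, $$\lim_{\varepsilon\to0}\int_{|z|<R}\int_{\mathbb{R}^N}\rho_\varepsilon(z)\,|u(x+z)-u(x)|^p\,dx\,dz=0.$$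
   Context: For a measurable function $u$ on $\mathbb{R}^N$ the nonlocal energy is $$\mathcal{F}_\varepsilon(u):=\iint_{\mathbb{R}^N\times\mathbb{R}^N}\rho_\varepsilon(y-x)\,|u(x)-u(y)|^p\,dx\,dy\in[0,+\infty].$$ ''$\mathcal{F}_\varepsilon(u)$ is well-defined'' means that $u$ belongs to $\{u\in L^p(\mathbb{R}^N):\mathcal{F}_\varepsilon(u)<+\infty\}$. Integrals of non-negative functions take values in $[0,+\infty]$. *)

(* Defs.v *)
From HB Require Import structures.
From mathcomp Require Import all_boot all_order all_algebra.
From mathcomp Require Import all_classical all_reals all_analysis.
From mathcomp Require Import measurable_realfun.

Set Implicit Arguments.
Unset Strict Implicit.
Unset Printing Implicit Defensive.
Import Order.TTheory GRing.Theory Num.Theory.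
Import numFieldNormedType.Exports.

Local Open Scope classical_set_scope.
Local Open Scope ring_scope.

(* R^n is 'rV[R]_n. Its sigma-algebra is generated by the coordinate maps, as
   for n.-tuple in MathComp-Analysis; over R it is the Borel sigma-algebra. *)
Definition rV_display : measure_display -> measure_display.
Proof. exact. Qed.

Section measurable_rV.
Context {d} {T : measurableType d} (n : nat).

Definition rV_coord (i : 'I_n) (x : 'rV[T]_n) : T := x ord0 i.

Let rV_set0 : g_sigma_preimage rV_coord set0.
Proof. exact: sigma_algebra0. Qed.

Let rV_setC A : g_sigma_preimage rV_coord A -> g_sigma_preimage rV_coord (~` A).
Proof. exact: sigma_algebraC. Qed.

Let rV_bigcup (F : _^nat) : (forall i, g_sigma_preimage rV_coord (F i)) ->
  g_sigma_preimage rV_coord (\bigcup_i (F i)).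
Proof. exact: sigma_algebra_bigcup. Qed.

HB.instance Definition _ := @isMeasurable.Build (rV_display d)
  'rV[T]_n (g_sigma_preimage rV_coord) rV_set0 rV_setC rV_bigcup.

End measurable_rV.

Section measurable_rV_theory.
Context d (T : measurableType d).

Lemma measurable_rV_coord n (i : 'I_n) :
  measurable_fun [set: 'rV[T]_n] (@rV_coord _ T n i).
Proof.
move=> _ Y mY; rewrite setTI; apply: sub_sigma_algebra => /=.
rewrite -bigcup_seq/=; exists i => /=; first by rewrite mem_index_enum.
by exists Y => //; rewrite setTI.
Qed.

Lemma measurable_fun_rV d' (X : measurableType d') n (f : X -> 'rV[T]_n) :
  (forall i, measurable_fun setT (fun x => rV_coord i (f x))) ->
  measurable_fun setT f.
Proof.
move=> mf; apply: (@measurability _ _ _ _ _ _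
  (\big[setU/set0]_(i < n)
     preimage_set_system setT (@rV_coord _ T n i) measurable)) => //.
move=> _ [A + <-]; rewrite -bigcup_seq => -[i _ [B mB <-]].
rewrite !setTI.
by have := mf i measurableT B mB; rewrite setTI.
Qed.

End measurable_rV_theory.

Section pushforward_sigma_finite.
Context d1 d2 (T1 : measurableType d1) (T2 : measurableType d2) (R : realType).
Context (mu : set T1 -> \bar R) (mu_sf : sigma_finite setT mu)
  (f : T1 -> T2) (g : T2 -> T1)
  (mg : measurable_fun setT g) (fK : cancel f g).

Lemma pushforward_sigma_finite : sigma_finite setT (pushforward mu f).
Proof.
have [F FT Ffin] := mu_sf.
exists (fun n => g @^-1` (F n)).
  by rewrite -preimage_bigcup -FT preimage_setT.
move=> n; have [mF Fy] := Ffin n; split.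
  by rewrite -[X in measurable X]setTI; exact: mg.
rewrite /pushforward -comp_preimage (_ : g \o f = idfun)//.
by apply/funext => x /=; rewrite fK.
Qed.

End pushforward_sigma_finite.

Lemma product_sigma_finite d1 d2 (T1 : measurableType d1)
    (T2 : measurableType d2) (R : realType)
    (m1 : {sigma_finite_measure set T1 -> \bar R})
    (m2 : {sigma_finite_measure set T2 -> \bar R}) :
  sigma_finite setT (m1 \x m2)%E.
Proof.
have /sigma_finiteP[F [TF ndF Foo]] := sigma_finiteT m1.
have /sigma_finiteP[G [TG ndG Goo]] := sigma_finiteT m2.
exists (fun n => F n `*` G n).
  rewrite -setXTT TF TG predeqE => -[x y]; split.
    move=> [/= [n _ Fnx] [k _ Gky]]; exists (maxn n k) => //; split.
    - by move: x Fnx; exact/subsetPset/ndF/leq_maxl.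
    - by move: y Gky; exact/subsetPset/ndG/leq_maxr.
  by move=> [n _ []/= ? ?]; split; exists n.
move=> k; have [? ?] := Foo k; have [? ?] := Goo k.
split; first exact: measurableX.
by rewrite product_measure1E// lte_mul_pinfty// ge0_fin_numE.
Qed.

Section lebesgue_rV.
Context {R : realType}.
Local Open Scope ereal_scope.

Section step.
Context n (mu : {sigma_finite_measure set 'rV[R]_n -> \bar R}).

(* (t, x) is sent to the row (t, x_0, ..., x_(n-1)). *)
Definition rV_cons (y : measurableTypeR R * 'rV[R]_n) : 'rV[R]_n.+1 :=
  \row_i (if unlift ord0 i is Some j then y.2 ord0 j else y.1).

Definition rV_uncons (x : 'rV[R]_n.+1) : measurableTypeR R * 'rV[R]_n :=
  (x ord0 ord0, \row_i x ord0 (lift ord0 i)).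

Lemma rV_consK : cancel rV_cons rV_uncons.
Proof.
case=> t x; rewrite /rV_uncons mxE unlift_none; congr pair.
by apply/rowP => i; rewrite !mxE liftK.
Qed.

Lemma measurable_rV_cons : measurable_fun setT rV_cons.
Proof.
apply: measurable_fun_rV => i; rewrite /rV_coord.
under eq_fun do rewrite mxE.
case: (unlift ord0 i) => [j|]; last exact: measurable_fst.
exact: (measurableT_comp (@measurable_rV_coord _ R n j) measurable_snd).
Qed.

Lemma measurable_rV_uncons : measurable_fun setT rV_uncons.
Proof.
apply: measurable_fun_pair; first exact: (@measurable_rV_coord _ R).
apply: measurable_fun_rV => i; rewrite /rV_coord.
under eq_fun do rewrite mxE.
exact: measurable_rV_coord.
Qed.

Definition lebesgue_rV_step : set 'rV[R]_n.+1 -> \bar R :=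
  pushforward (@lebesgue_measure R \x mu) rV_cons.

Let step0 : lebesgue_rV_step set0 = 0.
Proof. by rewrite /lebesgue_rV_step /pushforward preimage_set0 measure0. Qed.

Let step_ge0 A : 0 <= lebesgue_rV_step A.
Proof. exact: (measure_ge0 (@lebesgue_measure R \x mu)). Qed.

Let step_sigma_additive : semi_sigma_additive lebesgue_rV_step.
Proof.
have mpre A : measurable A -> measurable (rV_cons @^-1` A).
  by move=> mA; rewrite -[X in measurable X]setTI; exact: measurable_rV_cons.
move=> F mF tF mUF; rewrite /lebesgue_rV_step /pushforward preimage_bigcup.
apply: measure_semi_sigma_additive.
- by move=> k; exact: mpre.
- apply/trivIsetP => i j _ _ ij; rewrite -preimage_setI.
  by move/trivIsetP : tF => /(_ _ _ Logic.I Logic.I ij) ->; rewrite preimage_set0.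
- by rewrite -preimage_bigcup; exact: mpre.
Qed.

HB.instance Definition _ := isMeasure.Build _ _ _ lebesgue_rV_step
  step0 step_ge0 step_sigma_additive.

Let step_sigma_finite : sigma_finite setT lebesgue_rV_step.
Proof.
apply: (pushforward_sigma_finite _ measurable_rV_uncons rV_consK).
exact: product_sigma_finite.
Qed.

HB.instance Definition _ :=
  Measure_isSigmaFinite.Build _ _ _ lebesgue_rV_step step_sigma_finite.

End step.

(* Lebesgue measure on R^n: the point mass for n = 0, then the product of the
   Lebesgue measure on the first coordinate with the one on the n others. *)
Fixpoint lebesgue_rV n : {sigma_finite_measure set 'rV[R]_n -> \bar R} :=
  if n is m.+1 then lebesgue_rV_step (lebesgue_rV m)
  else @dirac _ 'rV[R]_0 0%R R.

End lebesgue_rV.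
Arguments lebesgue_rV : clear implicits.

Section definitions.
Context {R : realType} {N : nat}.
Implicit Types (u f : 'rV[R]_N -> R) (rho : R -> 'rV[R]_N -> R) (p r : R).

Local Notation mu := (lebesgue_rV R N).

(* The norm `|x| of 'rV[R]_N in the library is the sup norm. *)
Definition enorm (x : 'rV[R]_N) : R := Num.sqrt (\sum_i x ord0 i ^+ 2).

(* Measurability for the Lebesgue sigma-algebra, i.e. the completion of the
   Borel one.  The integral of a non-negative function is the supremum of the
   integrals of the Borel simple functions below it, so that on such functions
   it coincides with the integral for the completed measure. *)
Definition lebesgue_measurable_fun f :=
  forall B : set R, measurable B -> completed_algebra_gen mu (f @^-1` B).

Definition partials (s : seq 'I_N) u : 'rV[R]_N -> R :=
  foldr (fun i f => 'D_(delta_mx ord0 i) f) u s.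

Definition smooth u := forall s : seq 'I_N,
  continuous (partials s u) /\
  forall i x, derivable (partials s u) x (delta_mx ord0 i).

Definition Cc_infty u := smooth u /\ compact (closure [set x | u x != 0]).

Local Open Scope ereal_scope.

Definition energy p (k : 'rV[R]_N -> R) u : \bar R :=
  \int[mu \x mu]_xy (k (xy.2 - xy.1) * `|u xy.1 - u xy.2| `^ p)%:E.

Definition energy_well_defined p (k : 'rV[R]_N -> R) u :=
  u \in Lfun mu p%:E /\ energy p k u < +oo.

Definition mass_outside (k : 'rV[R]_N -> R) r : \bar R :=
  \int[mu]_(z in [set z | (r < enorm z)%R]) (k z)%:E.

Definition moment_inside p (k : 'rV[R]_N -> R) r : \bar R :=
  \int[mu]_(z in [set z | (enorm z < r)%R]) (enorm z `^ p * k z)%:E.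

Definition energy_inside p (k : 'rV[R]_N -> R) u r : \bar R :=
  \int[mu]_(z in [set z | (enorm z < r)%R])
    \int[mu]_x (k z * `|u (x + z) - u x| `^ p)%:E.

Definition uniform_moment_conditions p rho := forall r, (0 < r)%R ->
  mass_outside (rho e) r @[e --> 0^'+] --> 1 /\
  moment_inside p (rho e) r @[e --> 0^'+] --> 0.

(* lim_(r -> +oo) lim_(e -> 0+) F e r = l, the inner limit being required to
   exist in \bar R for all large r. *)
Definition iterated_limit (F : R -> R -> \bar R) (l : \bar R) :=
  exists g : R -> \bar R,
    (\forall r \near +oo%R, F e r @[e --> 0^'+] --> g r) /\
    g r @[r --> +oo%R] --> l.

Definition iterated_limits_conditions p rho :=
  iterated_limit (fun e => mass_outside (rho e)) 1 /\
  iterated_limit (fun e => moment_inside p (rho e)) 0.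

Definition mazya_shaposhnikova p rho := forall u, Cc_infty u ->
  [/\ \forall e \near 0^'+, energy_well_defined p (rho e) u,
      energy p (rho e) u @[e --> 0^'+] --> 2%:E * 'N[mu]_p%:E[EFin \o u] `^ p &
      forall r, (0 < r)%R ->
        energy_inside p (rho e) u r @[e --> 0^'+] --> 0].

End definitions.

(* Main.v *)
(* Write [D z] for the p-th power of the L^p norm of [u (x + z) - u x] as a
   function of [x], so that the energy of [u] is the integral of
   [rho_e z * D z].  For a test function, [D z <= C |z|^p] (Lipschitz bound)
   and [D z = 2 ||u||_p^p] as soon as [z] exceeds the diameter of the support:
   the energy is [2 ||u||_p^p] times the mass outside a large ball, up to the
   energy inside, which is at most [C] times a moment.  This gives (1) => (3).
   Conversely, if [u] coincides with the coordinate [x_i] on a large ball, then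
   [D z >= |z_i|^p] for [|z| < r], so the inside part of (3) controls the
   moments; then the formula for one nonzero [u] yields the mass outside a large
   ball.  When the moments vanish in the limit, the mass of any shell does too,
   hence the radius is irrelevant in the conditions on the mass; as moments are
   monotone in the radius, this also gives (2) => (1).  Finally, kernels are
   only Lebesgue measurable: each is replaced by a Borel one equal to it off a
   null set, which changes none of the integrals. *)

Require Import Defs.
From mathcomp Require Import all_boot all_order all_algebra.
From mathcomp Require Import all_classical all_reals all_analysis.
From mathcomp Require Import measurable_realfun ring lra.
Set Implicit Arguments.
Unset Strict Implicit.
Unset Printing Implicit Defensive.
Import Order.TTheory GRing.Theory Num.Theory.
Import numFieldNormedType.Exports.

Local Open Scope classical_set_scope.
Local Open Scope ring_scope.

(** * Lebesgue measure on row vectors *)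

Section borel_rV.
Context {R : realType}.
Implicit Types n : nat.

Definition box n (a b : 'rV[R]_n) : set 'rV[R]_n :=
  [set x | forall i, x ord0 i \in `[a ord0 i, b ord0 i]].

Lemma measurable_box n (a b : 'rV[R]_n) : measurable (box a b).
Proof.
rewrite (_ : box a b =
    \bigcap_(i : 'I_n) [set x | x ord0 i \in `[a ord0 i, b ord0 i]]); last first.
  by apply/seteqP; split=> [x bx i _|x bx i]; [exact: bx|exact: bx].
apply: fin_bigcap_measurable => //= i _.
have := @measurable_rV_coord _ R n i measurableT `[a ord0 i, b ord0 i]%classic.
by rewrite setTI; apply; exact: measurable_itv.
Qed.

(** Balls of ['rV[R]_n] are sup-norm cubes, so rational corners chosen within the radius of [x],
    coordinate by coordinate, span a box around [x] inside [U]. There are only countably many such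
    boxes. *)
Lemma open_measurable_rV n (U : set 'rV[R]_n) : open U -> measurable U.
Proof.
move=> oU.
pose F (q : 'rV[rat]_n * 'rV[rat]_n) : set 'rV[R]_n :=
  let B := box (map_mx ratr q.1) (map_mx ratr q.2) in
  if `[< B `<=` U >] then B else set0.
have -> : U = \bigcup_q F q.
  apply/seteqP; split => [x Ux|x [q _]]; last first.
    by rewrite /F; case: ifPn => // /asboolP; apply.
  have /nbhs_ballP[e /= e0 xeU] : nbhs x U by exact: open_nbhs_nbhs.
  have lo i : exists q, (x ord0 i - e < ratr q :> R) && (ratr q < x ord0 i).
    have [|q] := @rat_in_itvoo R (x ord0 i - e) (x ord0 i).
      by rewrite ltrBlDr ltrDl.
    by rewrite in_itv; exists q.
  have hi i : exists q, (x ord0 i < ratr q :> R) && (ratr q < x ord0 i + e).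
    have [|q] := @rat_in_itvoo R (x ord0 i) (x ord0 i + e); first by rewrite ltrDl.
    by rewrite in_itv; exists q.
  have [q1 q1P] := choice lo; have [q2 q2P] := choice hi.
  exists (\row_i q1 i, \row_i q2 i) => //; rewrite /F.
  case: ifPn => [_|/asboolP[] y /= By].
    move=> i; rewrite /= !mxE in_itv /=.
    by have /andP[/ltW -> _] := q2P i; have /andP[_ /ltW ->] := q1P i.
  apply: xeU; split=> // i j; rewrite (ord1 i) /ball /=.
  have := By j; rewrite !mxE in_itv /= => /andP[y1 y2].
  have /andP[_ q2x] := q2P j; have /andP[q1x _] := q1P j.
  rewrite ltr_distlC (lt_le_trans q1x y1) /=.
  exact: le_lt_trans y2 q2x.
apply: countable_bigcupT_measurable => [|q]; first exact: countableP.
by rewrite /F; case: ifPn => // _; exact: measurable_box.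
Qed.

Lemma continuous_measurable_rV n (u : 'rV[R]_n -> R) :
  continuous u -> measurable_fun setT u.
Proof.
move=> cu; apply: (measurability _ (RGenOInfty.measurableE R)).
move=> _ [_ [a ->] <-]; rewrite setTI.
apply: open_measurable_rV; apply: open_comp => //; exact: interval_open.
Qed.

Lemma measurable_rV_add n :
  measurable_fun setT (fun xy : 'rV[R]_n * 'rV[R]_n => xy.1 + xy.2).
Proof.
apply: measurable_fun_rV => i; rewrite /rV_coord.
under eq_fun do rewrite mxE.
apply: measurable_funD.
  exact: (measurableT_comp (@measurable_rV_coord _ R n i) measurable_fst).
exact: (measurableT_comp (@measurable_rV_coord _ R n i) measurable_snd).
Qed.

Lemma measurable_rV_sub n :
  measurable_fun setT (fun xy : 'rV[R]_n * 'rV[R]_n => xy.2 - xy.1).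
Proof.
apply: measurable_fun_rV => i; rewrite /rV_coord.
under eq_fun do rewrite !mxE.
apply: measurable_funB.
  exact: (measurableT_comp (@measurable_rV_coord _ R n i) measurable_snd).
exact: (measurableT_comp (@measurable_rV_coord _ R n i) measurable_fst).
Qed.

Lemma measurable_rV_addr n (v : 'rV[R]_n) :
  measurable_fun setT (fun x : 'rV[R]_n => x + v).
Proof.
apply: (measurableT_comp (@measurable_rV_add n) (g := fun x => (x, v))).
apply: measurable_fun_pair; [exact: measurable_id|exact: measurable_cst].
Qed.

Lemma measurable_enorm n : measurable_fun setT (@enorm R n).
Proof.
apply: (measurableT_comp (continuous_measurable_fun (@sqrt_continuous R))).
rewrite /=; apply: measurable_sum => i.
apply: measurable_funX.
exact: (@measurable_rV_coord _ R n i).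
Qed.

End borel_rV.

(** * Translation invariance of Lebesgue measure and volume of cubes *)

Section lebesgue_rV_theory.
Context {R : realType}.
Local Open Scope ereal_scope.

(** The translated measure gives each half-open interval its length, which characterizes Lebesgue
    measure on the line. *)
Lemma lebesgue_measure_translate (v : R) (A : set R) : measurable A ->
  (@lebesgue_measure R) ((fun x => x + v)%R @^-1` A) = (@lebesgue_measure R) A.
Proof.
move=> mA.
pose tr (x : measurableTypeR R) : measurableTypeR R := (x + v)%R.
have mv : measurable_fun setT tr.
  by apply: measurable_funD => //; exact: measurable_cst.
apply/esym; rewrite -[RHS]/(pushforward (@lebesgue_measure R) tr A).
apply: lebesgue_measure_unique => //= _ [[a b]] _ <-.
rewrite /pushforward (_ : _ @^-1` _ = `]a - v, b - v]%classic)%R; last first.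
  by apply/seteqP; split=> x; rewrite /= !in_itv/= ltrBlDr lerBrDr.
rewrite !lebesgue_measure_itv/= !lte_fin ltrD2r; case: ifPn => // _.
by rewrite -!EFinD opprB addrA subrK.
Qed.

(** Induction on the dimension: through [rV_cons], translation by [v] acts separately on the head
    and on the tail. The translated product measure thus has the right value on rectangles, which
    determines it. *)
Lemma lebesgue_rV_translate n (v : 'rV[R]_n) (A : set 'rV[R]_n) :
  measurable A -> lebesgue_rV R n ((fun x => x + v)%R @^-1` A) = lebesgue_rV R n A.
Proof.
elim: n v A => [|n IH] v A mA.
  congr (lebesgue_rV R 0 _); apply/funext => x /=.
  by congr A; apply/rowP => -[].
pose w := (v ord0 ord0, \row_i v ord0 (lift ord0 i))%R : measurableTypeR R * 'rV[R]_n.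
pose tr (y : measurableTypeR R * 'rV[R]_n) : measurableTypeR R * 'rV[R]_n :=
  (y.1 + w.1, y.2 + w.2)%R.
have mtr : measurable_fun setT tr.
  apply: measurable_fun_pair.
    by apply: measurable_funD; [exact: measurable_fst|exact: measurable_cst].
  exact: (measurableT_comp (measurable_rV_addr _) measurable_snd).
have mcA : measurable ((@rV_cons R n) @^-1` A).
  by rewrite -[X in measurable X]setTI; exact: measurable_rV_cons.
rewrite /= /lebesgue_rV_step /pushforward.
transitivity
  ((lebesgue_measure \x lebesgue_rV R n) (tr @^-1` ((@rV_cons R n) @^-1` A))).
  congr (_ _); apply/funext => -[t x] /=; congr A.
  apply/rowP => i; rewrite !mxE /=.
  by case: unliftP => [j ->|->] //; rewrite !mxE ord1.
rewrite -[LHS]/(pushforward (lebesgue_measure \x lebesgue_rV R n) tr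
  ((@rV_cons R n) @^-1` A)).
apply/esym; apply: product_measure_unique => // B C mB mC.
rewrite /= /pushforward (_ : tr @^-1` _ =
  ((fun x => x + w.1)%R @^-1` B) `*` ((fun x => x + w.2)%R @^-1` C)) //.
rewrite product_measure1E //.
- congr (_ * _); first exact: lebesgue_measure_translate.
  exact: IH.
- rewrite -[X in measurable X]setTI.
  by apply: (measurable_funD (@measurable_id _ _ _) (measurable_cst _)).
- by rewrite -[X in measurable X]setTI; exact: measurable_rV_addr.
Qed.

Lemma ge0_integral_translate n (v : 'rV[R]_n) (f : 'rV[R]_n -> \bar R) :
  measurable_fun setT f -> (forall x, 0 <= f x) ->
  \int[lebesgue_rV R n]_x f (x + v)%R = \int[lebesgue_rV R n]_x f x.
Proof.
move=> mf f0.
have := @ge0_integral_pushforward _ _ _ _ R _ (measurable_rV_addr v)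
  (lebesgue_rV R n) setT f measurableT mf.
rewrite preimage_setT => <- //.
apply: eq_measure_integral; first exact: measurable_rV_addr.
by move=> mT A mA _; exact: lebesgue_rV_translate.
Qed.

Lemma lebesgue_rV_box n (a b : R) : (a <= b)%R ->
  lebesgue_rV R n (box (const_mx a) (const_mx b)) = ((b - a) ^+ n)%:E.
Proof.
move=> ab; elim: n => [|n IH].
  rewrite expr0 /= diracE mem_set //; by case.
rewrite /= /lebesgue_rV_step /pushforward.
rewrite (_ : _ @^-1` _ = `[a, b]%classic `*` box (const_mx a) (const_mx b)); last first.
  apply/seteqP; split => [[t x] /= bx|[t x] /= [tab bx] i].
    split.
      by have := bx ord0; rewrite !mxE unlift_none.
    by move=> i; have := bx (lift ord0 i); rewrite !mxE liftK.
  rewrite !mxE; case: unliftP => [j _|_] //.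
  by have := bx j; rewrite !mxE.
rewrite product_measure1E//; [|exact: measurable_box].
rewrite exprS EFinM; congr (_ * _); last exact: IH.
rewrite [LHS]lebesgue_measure_itv/= lte_fin -EFinB.
by case: ltgtP ab => // -> _; rewrite subrr.
Qed.

End lebesgue_rV_theory.

(** * Replacement of Lebesgue measurable functions by Borel ones *)

Section ae_borel.
Context {R : realType}.
Local Open Scope ereal_scope.

Import HBNNSimple.

(* [f] and [g] are arbitrary: a simple function below [f], truncated to the
   complement of [Z], is below [g] and has the same integral. *)
Lemma ge0_le_integral_off_null d (T : measurableType d)
    (mu : {measure set T -> \bar R})
    (Z : set T) (f g : T -> \bar R) : measurable Z -> mu Z = 0 ->
  (forall x, 0 <= f x) -> (forall x, 0 <= g x) ->
  (forall x, ~ Z x -> f x <= g x) ->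
  \int[mu]_x f x <= \int[mu]_x g x.
Proof.
move=> mZ Z0 f0 g0 fg.
rewrite ge0_integralE// ge0_integralE// !patch_setT.
apply: ge_ereal_sup => /= _ [h /= hf <-].
have mZC : measurable (~` Z) by exact: measurableC.
pose h' := proj_nnsfun h mZC.
apply: ereal_sup_ubound; exists h' => /=.
  move=> x; rewrite /h' /= /mindic indicE.
  have [Zx|nZx] := pselect (Z x).
    by rewrite memNset ?mulr0 // => /(_ Zx).
  by rewrite mem_set // mulr1; exact: le_trans (hf x) (fg x nZx).
rewrite -!integralT_nnsfun.
apply: ge0_ae_eq_integral => //.
- exact/measurable_EFinP.
- exact/measurable_EFinP.
- by move=> x _; rewrite lee_fin.
- by move=> x _; rewrite lee_fin.
- exists Z; split => // x /= hx; apply: contrapT => nZx; apply: hx => _.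
  by rewrite /h' /= /mindic indicE mem_set // mulr1.
Qed.

Lemma ge0_eq_integral_off_null d (T : measurableType d)
    (mu : {measure set T -> \bar R})
    (Z D : set T) (f g : T -> \bar R) : measurable Z -> mu Z = 0 ->
  (forall x, 0 <= f x) -> (forall x, 0 <= g x) ->
  (forall x, ~ Z x -> f x = g x) ->
  \int[mu]_(x in D) f x = \int[mu]_(x in D) g x.
Proof.
move=> mZ Z0 f0 g0 fg; rewrite integral_mkcond [RHS]integral_mkcond.
have f0' x : 0 <= (f \_ D) x by rewrite patchE; case: ifP.
have g0' x : 0 <= (g \_ D) x by rewrite patchE; case: ifP.
by apply/eqP; rewrite eq_le; apply/andP; split;
  apply: (ge0_le_integral_off_null mZ Z0) => // x nZx; rewrite !patchE fg.
Qed.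

(* Set [f] to [0] on the union over rationals [q] of null sets off which
   [f @^-1` `]q, +oo[] is Borel. *)
Lemma lebesgue_measurable_borel n (f : 'rV[R]_n -> R) :
  lebesgue_measurable_fun f -> (forall x, 0 <= f x)%R ->
  exists (g : 'rV[R]_n -> R) (Z : set 'rV[R]_n),
    [/\ measurable_fun setT g, (forall x, 0 <= g x)%R,
    measurable Z, lebesgue_rV R n Z = 0 & forall x, ~ Z x -> f x = g x].
Proof.
move=> mf f0.
have dec (q : rat) : exists A, exists Z, [/\ measurable A, measurable Z,
    lebesgue_rV R n Z = 0, A `<=` f @^-1` `]ratr q, +oo[ &
    f @^-1` `]ratr q, +oo[ `<=` A `|` Z].
  have [|A mA [M [Z [mZ Z0 MZ]] AM]] := mf `]ratr q, +oo[%classic.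
    exact: measurable_itv.
  exists A, Z; split => //; rewrite -AM; [exact: subsetUl|exact: setUS].
have [A /choice[Z AZ]] := choice dec.
exists (fun x => if `[< (\bigcup_q Z q) x >] then 0 else f x)%R, (\bigcup_q Z q).
have mZ : measurable (\bigcup_q Z q).
  by apply: countable_bigcupT_measurable => [|q]; [exact: countableP|case: (AZ q)].
split => //.
- apply: (measurability _ (RGenOInfty.measurableE R)).
  move=> _ [_ [a ->] <-]; rewrite setTI.
  (* The modified function is [0] on the exceptional set and nonnegative elsewhere: a negative level
     gives the whole space, and for [a >= 0] the exceptional set contributes nothing. *)
  have [a0|a0] := ltP a 0%R.
    rewrite (_ : _ @^-1` _ = setT) //; apply/seteqP; split => // x _ /=.
    by rewrite in_itv/= andbT; case: ifP => // _; exact: lt_le_trans (f0 x).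
  rewrite (_ : _ @^-1` _ =
      \bigcup_(q in [set q : rat | (a <= ratr q)%R]) (A q `\` \bigcup_q Z q)).
    rewrite bigcup_mkcond.
    apply: countable_bigcupT_measurable => [|q]; first exact: countableP.
    case: ifPn => // _; apply: measurableD => //; by case: (AZ q).
  apply/seteqP; split => [x /=|x [q /= aq [Aqx nZ]]].
    rewrite in_itv/= andbT; case: ifPn => [_|/asboolP nZ afx].
      by rewrite ltNge a0.
    have [q] := rat_in_itvoo afx; rewrite in_itv/= => /andP[aq qf].
    exists q; first exact: ltW.
    split => //; have [_ _ _ _ /(_ x)] := AZ q.
    rewrite /= in_itv/= andbT => /(_ qf) [//|Zq].
    by exfalso; apply: nZ; exists q.
  rewrite in_itv/= andbT; case: ifPn => [/asboolP//|_].
  have [_ _ _ /(_ x Aqx)] := AZ q.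
  by rewrite /= in_itv/= andbT => qf _; exact: le_lt_trans qf.
- by move=> x; case: ifP.
(* Subadditivity is indexed by [nat], hence this enumeration of the rationals, with value [0] where
   [unpickle] fails. *)
- have [F bF] : exists F : nat -> rat, forall q, exists k, F k = q.
    by exists (fun k => odflt 0%R (unpickle k)) => q; exists (pickle q); rewrite pickleK.
  apply/eqP; rewrite eq_le measure_ge0 andbT.
  have -> : \bigcup_q Z q = \bigcup_k Z (F k).
    apply/seteqP; split => x [q _ Zx]; last by exists (F q).
    by have [k Fk] := bF q; exists k => //; rewrite Fk.
  apply: le_trans (measure_sigma_subadditive _ _ _ (@subset_refl _ _)) _.
  - by move=> k; case: (AZ (F k)).
  - by apply: bigcup_measurable => k _; case: (AZ (F k)).
  - by rewrite eseries0 // => k _ _; case: (AZ (F k)).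
- by move=> x nZ; case: ifPn => // /asboolP.
Qed.

End ae_borel.

(** * The Euclidean norm: comparison with coordinates, measurability of balls *)

Section euclidean_norm.
Context {R : realType} {N : nat}.
Implicit Types z : 'rV[R]_N.

Lemma enorm_ge0 z : 0 <= enorm z.
Proof. exact: sqrtr_ge0. Qed.

Lemma coord_le_enorm z i : `|z ord0 i| <= enorm z.
Proof.
rewrite /enorm -(sqrtr_sqr (z ord0 i)) ler_wsqrtr//.
by rewrite (bigD1 i)//= lerDl sumr_ge0// => j _; exact: sqr_ge0.
Qed.

Lemma enorm_le_coord z (a : R) : 0 <= a -> (forall i, `|z ord0 i| <= a) ->
  enorm z <= Num.sqrt N%:R * a.
Proof.
move=> a0 za; rewrite -{1}(ger0_norm a0) -sqrtr_sqr -sqrtrM// ler_wsqrtr//.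
rewrite mulr_natl -[X in _ *+ X]card_ord -sumr_const ler_sum// => i _.
by rewrite -(real_normK (num_real (z ord0 i))) lerXn2r// nnegrE.
Qed.

(** The norm is at most [sqrt N] times the largest coordinate, whose power is one term of the sum.
    This reduces moments to single coordinates, each of which can be tested by one function. *)
Lemma enorm_powR_le z (p : R) : 1 <= p ->
  enorm z `^ p <= Num.sqrt N%:R `^ p * \sum_i `|z ord0 i| `^ p.
Proof.
move=> p1; have p0 : 0 <= p by rewrite (le_trans ler01).
(* For [N = 0] there is no largest coordinate; then the norm is [0], and so is its power because [p]
   is positive. *)
have [i0 _|noI] := pickP 'I_N; last first.
  rewrite /enorm big1 => [|i]; last by have := noI i.
  rewrite sqrtr0 powR0 ?gt_eqF ?(lt_le_trans ltr01)// mulr_ge0 ?powR_ge0//.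
  by rewrite sumr_ge0// => i; rewrite powR_ge0.
case: (@arg_maxP _ _ _ i0 xpredT (fun i => `|z ord0 i|)) => // j _ jmax.
apply: (@le_trans _ _ ((Num.sqrt N%:R * `|z ord0 j|) `^ p)).
  apply: ge0_ler_powR; rewrite ?nnegrE ?enorm_ge0 ?mulr_ge0 ?sqrtr_ge0//.
  by apply: enorm_le_coord => // i; exact: jmax.
rewrite powRM ?sqrtr_ge0// ler_wpM2l ?powR_ge0// (bigD1 j)//= lerDl.
by rewrite sumr_ge0// => i _; rewrite powR_ge0.
Qed.

Lemma measurable_enorm_lt r : measurable [set z : 'rV[R]_N | enorm z < r].
Proof.
have := @measurable_enorm R N measurableT `]-oo, r[%classic.
rewrite setTI (_ : _ @^-1` _ = [set z | enorm z < r]); last first.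
  by apply/seteqP; split=> z /=; rewrite in_itv.
by apply; exact: measurable_itv.
Qed.

Lemma measurable_enorm_gt r : measurable [set z : 'rV[R]_N | r < enorm z].
Proof.
have := @measurable_enorm R N measurableT `]r, +oo[%classic.
rewrite setTI (_ : _ @^-1` _ = [set z | r < enorm z]); last first.
  by apply/seteqP; split=> z /=; rewrite in_itv/= andbT.
by apply; exact: measurable_itv.
Qed.

End euclidean_norm.
#[global] Hint Extern 0 (measurable _) =>
  solve [exact: measurable_enorm_lt] : core.
#[global] Hint Extern 0 (measurable _) =>
  solve [exact: measurable_enorm_gt] : core.

(** * Smooth functions with compact support *)

Section differentiability_classes.
Context {R : realType}.

(** Both difference quotients are the same function of [h]. The one-variable chain rule and mean
    value theorem thereby apply to directional derivatives. *)
Lemma is_derive_line (V : normedModType R) (u : V -> R) (x v : V) (t l : R) :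
  is_derive t (1 : R) (fun s : R => u (x + s *: v)) l <->
  is_derive (x + t *: v) v u l.
Proof.
have E : (fun h : R => h^-1 *: (((fun s : R => u (x + s *: v)) \o shift t) (h *: (1 : R))
    - u (x + t *: v))) =
  (fun h : R => h^-1 *: ((u \o shift (x + t *: v)) (h *: v) - u (x + t *: v))).
  by apply/funext => h /=; rewrite [h *: 1]mulr1 scalerDl addrCA.
split=> -[d1 d2]; constructor.
- by move: d1; rewrite /derivable E.
- by move: d2; rewrite /derive E.
- by rewrite /derivable E.
- by rewrite /derive E.
Qed.

Section classes.
Context {V : normedModType R} {I : Type} (e : I -> V).

(** Derivatives enter as existential witnesses rather than as values of ['D], so that closure
    properties follow from the differentiation rules by induction on [n]. *)
Fixpoint Ck n (u : V -> R) : Prop := continuous u /\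
  if n is m.+1 then
    forall i, exists2 d, (forall x, is_derive x (e i) u (d x)) & Ck m d
  else True.

Lemma Ck_continuous n u : Ck n u -> continuous u.
Proof. by case: n => [|n] []. Qed.

Lemma CkS n u : Ck n.+1 u -> Ck n u.
Proof.
elim: n u => [|n IH] u [cu du]; split=> // i.
by have [d ud /IH] := du i; exists d.
Qed.

Lemma Ck_cst n c : Ck n (cst c).
Proof.
elim: n c => [|n IH] c; (split; first exact: cst_continuous) => //.
by move=> i; exists (cst 0) => // x; exact: is_derive_cst.
Qed.

Lemma CkD n u v : Ck n u -> Ck n v -> Ck n (u + v).
Proof.
elim: n u v => [|n IH] u v [cu du] [cv dv].
  by split=> // x; apply: continuousD; [exact: cu|exact: cv].
split; first by move=> x; apply: continuousD; [exact: cu|exact: cv].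
move=> i; have [d ud Cd] := du i; have [d' vd' Cd'] := dv i.
by exists (d + d'); [move=> x; exact: is_deriveD|exact: IH].
Qed.

(** By the Leibniz rule the derivative contains [u] and [v] themselves, which [CkS] first lowers to
    class [n]. *)
Lemma CkM n u v : Ck n u -> Ck n v -> Ck n (u * v).
Proof.
elim: n u v => [|n IH] u v Cu Cv.
  split=> // x.
  by apply: continuousM; [exact: (Ck_continuous Cu)|exact: (Ck_continuous Cv)].
have [cu du] := Cu; have [cv dv] := Cv.
split; first by move=> x; apply: continuousM; [exact: cu|exact: cv].
move=> i; have [d ud Cd] := du i; have [d' vd' Cd'] := dv i.
exists (u * d' + v * d); first by move=> x; exact: is_deriveM.
by apply: CkD; apply: IH => //; exact: CkS.
Qed.

Lemma Ck_prod n J (s : seq J) (f : J -> V -> R) :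
  (forall j, Ck n (f j)) -> Ck n (fun x => \prod_(j <- s) f j x).
Proof.
move=> Cf; elim: s => [|j s IH].
  by under eq_fun do rewrite big_nil; exact: Ck_cst.
under eq_fun do rewrite big_cons.
exact: CkM.
Qed.

End classes.

(** The one-element family of directions for which [Ck] is the usual class of functions on the
    line. *)
Definition dir1 (_ : unit) : R := 1.

(** Chain rule: [phi] grows at the constant rate [c i] along [e i], so the derivative is [d \o phi]
    times a constant, and the induction hypothesis applies to [d]. *)
Lemma Ck_comp_affine (V : normedModType R) (I : Type) (e : I -> V)
    (phi : V -> R) (c : I -> R) n f :
  continuous phi -> (forall i h x, phi (x + h *: e i) = phi x + h * c i) ->
  Ck dir1 n f -> Ck e n (f \o phi).
Proof.
move=> cphi phiE; elim: n f => [|n IH] f [cf df].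
  by split=> // x; apply: continuous_comp; [exact: cphi|exact: cf].
split; first by move=> x; apply: continuous_comp; [exact: cphi|exact: cf].
move=> i; have [d fd Cd] := df tt.
exists ((d \o phi) * cst (c i)); last by apply: CkM; [exact: IH|exact: Ck_cst].
move=> x.
(* The point [x] is written as [x + 0 *: e i], in order to differentiate along the line at time
   [0]. *)
rewrite -[x in is_derive x](addr0 x) -(scale0r (e i)); apply/is_derive_line.
rewrite (_ : (fun s => _) = f \o (fun s => phi x + s * c i)); last first.
  by apply/funext => s /=; rewrite phiE.
apply: is_derive1_comp; first by rewrite mul0r addr0; exact: fd.
have := @is_deriveD R R R (cst (phi x)) ( *%R^~ (c i)) 0 1 0 (c i).
rewrite add0r; apply.
have -> : ( *%R^~ (c i)) = c i \*: (@id R) by apply/funext => s /=; rewrite mulrC.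
by have := @is_deriveZ R R R id (c i) 0 1 1; rewrite /GRing.scale /= mulr1; apply.
Qed.

(** The derivative [- d / f ^ 2] is a product of functions already known to be of class [n]. *)
Lemma CkV n (f : R -> R) : (forall x, f x != 0) -> Ck dir1 n f ->
  Ck dir1 n (fun x => (f x)^-1).
Proof.
move=> f0; elim: n => [|n IH] Cf.
  by split=> // x; apply: continuousV => //; exact: (Ck_continuous Cf).
have [cf df] := Cf.
split; first by move=> x; apply: continuousV => //; exact: cf.
move=> -[]; have [d fd Cd] := df tt.
exists (cst (-1) * ((fun x => (f x)^-1) * (fun x => (f x)^-1) * d)).
  move=> x; have := is_deriveV (f0 x) (fd x).
  congr is_derive; rewrite /GRing.scale /= [RHS]mulN1r mulNr.
  by rewrite expr2 invfM.
apply: CkM; first exact: Ck_cst.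
by apply: CkM => //; apply: CkM; apply: IH; exact: CkS.
Qed.

End differentiability_classes.

(** * A smooth plateau function on the line *)

Section smooth_bump.
Context {R : realType}.

(** [flat 0] is the classical smooth function with all derivatives zero at the origin; the powers of
    [t^-1] complete it to a family in which derivatives are combinations of members. *)
Definition flat k (t : R) : R := if 0 < t then t^-1 ^+ k * expR (- t^-1) else 0.

Lemma flat_ge0 k t : 0 <= flat k t.
Proof.
rewrite /flat; case: ifP => // t0.
by rewrite mulr_ge0 ?expR_ge0// exprn_ge0// invr_ge0 ltW.
Qed.

Lemma flat_gt0 k t : 0 < t -> 0 < flat k t.
Proof.
by move=> t0; rewrite /flat t0 mulr_gt0 ?expR_gt0// exprn_gt0// invr_gt0.
Qed.

Lemma flat_le0 k t : t <= 0 -> flat k t = 0.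
Proof. by rewrite /flat ltNge => ->. Qed.

(** With [s = t^-1], the exponential [expR s] dominates [s ^+ k.+1] divided by a factorial. The
    bound makes every [flat k] tend to [0] at the origin. *)
Lemma flat_lin k t : flat k t <= k.+1`!%:R * `|t|.
Proof.
have [t0|t0] := ltP 0 t; last by rewrite flat_le0// mulr_ge0.
rewrite /flat t0 gtr0_norm//.
have s0 : 0 < t^-1 by rewrite invr_gt0.
have := expR_ge1Dxn k (ltW s0).
move=> /(le_trans _) => /(_ (t^-1 ^+ k.+1 / (k.+1)`!%:R)).
rewrite lerDr ler01 => /(_ isT).
rewrite ler_pdivrMr ?ltr0n ?fact_gt0// expRN => H.
rewrite ler_pdivrMr ?expR_gt0// -(ler_pM2l s0) -exprS.
by rewrite (le_trans H)// -mulrA mulrCA mulKf ?gt_eqF// mulrC.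
Qed.

Lemma is_derive_flat k (x : R) :
  is_derive x 1 (flat k) (flat k.+2 x - k%:R * flat k.+1 x).
Proof.
have [x0|x0|->] := ltgtP x 0.
- rewrite !flat_le0 1?ltW// mulr0 subr0.
  apply: (@near_eq_is_derive R R R (cst 0)).
    near=> t; rewrite flat_le0 ?ltW//; near: t; exact: lt_nbhsl.
- apply: (@near_eq_is_derive R R R (fun t => t^-1 ^+ k * expR (- t^-1))).
    near=> t; rewrite /flat ifT//; near: t; exact: lt_nbhsr.
  have dV : is_derive x 1 (fun t : R => t^-1) (- x ^- 2).
    have := @is_deriveV R id x 1 1; rewrite /GRing.scale /= mulr1; apply.
      by rewrite gt_eqF.
  have dX : is_derive x 1 (fun t : R => t^-1 ^+ k) ((k%:R * x^-1 ^+ k.-1) * (- x ^- 2)).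
    rewrite (_ : (fun t : R => _) = (fun t : R => t^-1) ^+ k); last first.
      by rewrite exprfctE.
    exact: is_deriveX.
  have dE : is_derive x 1 (fun t : R => expR (- t^-1)) (expR (- x^-1) * x ^- 2).
    apply: (@is_derive1_comp R expR (fun t => - t^-1)).
    by have := is_deriveN dV; rewrite opprK.
  have := is_deriveM dX dE; congr is_derive.
  rewrite /flat x0 /GRing.scale /=.
  rewrite -exprVn.
  case: k {dX} => [|k] /=; first by rewrite !mul0r mulr0 subr0 addr0 expr0 mul1r mulrC.
  rewrite (exprD _ 2 k.+1) !exprS expr0 !mulr1 mulrN.
  by ring.
- rewrite !flat_le0// mulr0 subr0.
  (* At the origin the difference quotient of [flat k] is [flat k.+1], which tends to [0] by
     [flat_lin]. *)
  have cf : h^-1 *: ((flat k \o shift 0) (h *: (1 : R)) - flat k 0)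
      @[h --> 0^'] --> (0 : R).
    apply: (cvg_trans (G := flat k.+1 h @[h --> (0:R)^'])).
      apply: near_eq_cvg; near=> h.
      rewrite /= addr0 (flat_le0 _ (lexx 0)) subr0 /GRing.scale /= mulr1.
      by rewrite /flat; case: ifP => _; rewrite ?mulr0// exprS mulrA.
    apply/cvgrPdist_le => /= eps eps0.
    near=> h; rewrite sub0r normrN ger0_norm ?flat_ge0//.
    apply: le_trans (flat_lin _ _) _.
    rewrite mulrC -ler_pdivlMr ?ltr0n ?fact_gt0//.
    near: h; apply: dnbhs0_le; by rewrite divr_gt0 ?ltr0n ?fact_gt0.
  constructor; first by apply/cvg_ex; exists 0.
  exact: cvg_lim cf.
Unshelve. all: by end_near. Qed.

Lemma flat_continuous k : continuous (flat k).
Proof.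
move=> x; apply: differentiable_continuous; apply/derivable1_diffP.
exact: (@ex_derive _ _ _ _ _ _ _ (is_derive_flat k x)).
Qed.

Lemma Ck_flat n k : Ck dir1 n (flat k).
Proof.
elim: n k => [|n IH] k; (split; first exact: flat_continuous) => //.
move=> -[]; exists (flat k.+2 + cst (- k%:R) * flat k.+1).
  by move=> x; have := is_derive_flat k x; congr is_derive; rewrite /= mulNr.
by apply: CkD => //; apply: CkM => //; exact: Ck_cst.
Qed.

Definition smooth_step (s : R) : R := flat 0 s / (flat 0 s + flat 0 (1 - s)).

(** The numbers [s] and [1 - s] are never both nonpositive. *)
Let step_den_gt0 s : 0 < flat 0 s + flat 0 (1 - s).
Proof.
have [s0|s0] := ltP 0 s.
  by apply: ltr_pwDl; rewrite ?flat_gt0 ?flat_ge0.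
by rewrite ltr_wpDl ?flat_ge0// flat_gt0// subr_gt0 (le_lt_trans s0).
Qed.

Lemma smooth_step_le0 s : s <= 0 -> smooth_step s = 0.
Proof. by move=> s0; rewrite /smooth_step flat_le0// mul0r. Qed.

Lemma smooth_step_ge1 s : 1 <= s -> smooth_step s = 1.
Proof.
move=> s1; rewrite /smooth_step (@flat_le0 _ (1 - s)) ?subr_le0// addr0 divff//.
by rewrite gt_eqF// flat_gt0// (lt_le_trans ltr01).
Qed.

Lemma Ck_affine n (a b : R) f : Ck dir1 n f -> Ck dir1 n (fun x => f (a * x + b)).
Proof.
move=> Cf.
apply: (@Ck_comp_affine R R unit dir1 (fun x => a * x + b) (fun=> a)) => //.
  by move=> x; apply: continuousD; [apply: mulrl_continuous|exact: cst_continuous].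
by move=> [] h x; rewrite [h *: _]mulr1 mulrDr addrAC [h * a]mulrC.
Qed.

Lemma Ck_smooth_step n : Ck dir1 n smooth_step.
Proof.
apply: CkM; first exact: Ck_flat.
apply: CkV; first by move=> x; rewrite gt_eqF.
apply: CkD; first exact: Ck_flat.
have := @Ck_affine n (-1) 1 _ (Ck_flat n 0).
by congr Ck; apply/funext => x; rewrite mulN1r addrC.
Qed.

(** The first factor falls from [1] to [0] across [[a, a + 1]], the second one rises from [0] to [1]
    across [[- a - 1, - a]]. *)
Definition plateau (a t : R) : R := smooth_step (a + 1 - t) * smooth_step (a + 1 + t).

Lemma Ck_plateau n a : Ck dir1 n (plateau a).
Proof.
apply: CkM.
  have := @Ck_affine n (-1) (a + 1) _ (Ck_smooth_step n).
  by congr Ck; apply/funext => x; rewrite mulN1r addrC.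
have := @Ck_affine n 1 (a + 1) _ (Ck_smooth_step n).
by congr Ck; apply/funext => x; rewrite mul1r addrC.
Qed.

Lemma plateau_eq1 a t : `|t| <= a -> plateau a t = 1.
Proof.
rewrite ler_norml => /andP[t1 t2].
by rewrite /plateau !smooth_step_ge1 ?mulr1// addrAC lerDr ?subr_ge0// -lerBlDl sub0r.
Qed.

Lemma plateau_neq0 a t : plateau a t != 0 -> `|t| <= a + 1.
Proof.
apply: contraNT; rewrite -ltNge ltr_normr => /orP[t0|t0].
  by rewrite /plateau smooth_step_le0 ?mul0r// subr_le0 ltW.
by rewrite /plateau [X in _ * X]smooth_step_le0 ?mulr0//; lra.
Qed.

End smooth_bump.

(** * Test functions on row vectors and their uniform bounds *)

Section smooth_rV.
Context {R : realType} {N : nat}.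
Local Notation dirs := (fun i : 'I_N => delta_mx ord0 i : 'rV[R]_N).

(** The induction removes the last index of the list because [partials] differentiates along that
    one first; the witness [d] given by [Ck] is then the value of ['D]. *)
Lemma Ck_smooth (u : 'rV[R]_N -> R) : (forall n, Ck dirs n u) -> smooth u.
Proof.
move=> Cu s; elim/last_ind: s u Cu => [|s i IH] u Cu.
  split=> [|i x]; first exact: (Ck_continuous (Cu 0)).
  have [_ /(_ i)[d ud _]] := Cu 1; exact: (@ex_derive _ _ _ _ _ _ _ (ud x)).
rewrite /partials -cats1 foldr_cat /=; apply: IH => n.
have [_ /(_ i)[d ud Cd]] := Cu n.+1.
rewrite (_ : (fun _ => _) = d) //; apply/funext => x.
exact: (@derive_val _ _ _ _ _ _ _ (ud x)).
Qed.

Lemma Ck_coord n (f : R -> R) (j : 'I_N) : Ck dir1 n f ->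
  Ck dirs n (fun x => f (x ord0 j)).
Proof.
apply: (@Ck_comp_affine R _ _ dirs (fun x => x ord0 j) (fun i => (i == j)%:R)).
  by move=> x; exact: coord_continuous.
by move=> i h x; rewrite !mxE eqxx /= eq_sym.
Qed.

Lemma Ck_id n : Ck dir1 n (@id R).
Proof.
case: n => [|n]; split=> //; do ?[by move=> x].
by move=> []; exists (cst 1); [move=> x; exact: is_derive_id|exact: Ck_cst].
Qed.

Definition smooth_bump (a : R) (x : 'rV[R]_N) : R := \prod_j plateau a (x ord0 j).

Lemma Ck_bump n a : Ck dirs n (smooth_bump a).
Proof. by apply: Ck_prod => j; apply: Ck_coord; exact: Ck_plateau. Qed.

Lemma bump_eq1 a (x : 'rV[R]_N) : (forall j, `|x ord0 j| <= a) -> smooth_bump a x = 1.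
Proof. by move=> xa; rewrite /smooth_bump big1// => j _; rewrite plateau_eq1. Qed.

Lemma compact_box (a b : 'rV[R]_N) : compact (box a b).
Proof.
rewrite (_ : box a b = [set x | forall j, `[a ord0 j, b ord0 j]%classic (x ord0 j)]) //.
by apply: (rV_compact (A := fun j => `[a ord0 j, b ord0 j]%classic)) => j;
  exact: segment_compact.
Qed.

(** The product vanishes off the box of half-side [a + 1], so its support is a closed subset of a
    compact set. *)
Lemma Cc_infty_bump_mul a (u : 'rV[R]_N -> R) : (forall n, Ck dirs n u) ->
  Cc_infty (u * smooth_bump a).
Proof.
move=> Cu; split; first by apply: Ck_smooth => n; apply: CkM => //; exact: Ck_bump.
pose K : set 'rV[R]_N := box (const_mx (- (a + 1))) (const_mx (a + 1)).
have cK : compact K by exact: compact_box.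
apply: (subclosed_compact _ cK); first exact: closed_closure.
rewrite [X in _ `<=` X]((closure_id K).1 (compact_closed (@norm_hausdorff _ _) cK)).
apply: closure_subset => x; rewrite /= mulf_eq0 negb_or => /andP[_].
rewrite /smooth_bump prodf_seq_neq0 => /allP bx j.
rewrite !mxE in_itv /= -ler_norml; apply: plateau_neq0.
by apply: (implyP (bx j _)); rewrite ?mem_index_enum.
Qed.

Section Cc_infty_theory.
Variable u : 'rV[R]_N -> R.
Hypothesis Ccu : Cc_infty u.

Lemma Cc_infty_continuous : continuous u.
Proof. by case: Ccu => /(_ [::])[]. Qed.

Lemma Cc_infty_measurable : measurable_fun setT u.
Proof. by apply: continuous_measurable_rV; exact: Cc_infty_continuous. Qed.

Lemma Cc_infty_support : exists2 M : R, 0 < M &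
  forall x, u x != 0 -> forall i, `|x ord0 i| <= M.
Proof.
have [M [_ MK]] := compact_bounded Ccu.2.
(* [compact_bounded] gives a bound by every real strictly above [M]; this one is also positive. *)
exists (`|M| + 1); first by rewrite ltr_wpDl.
move=> x ux i; apply: (@le_trans _ _ `|x|).
  rewrite [leRHS]/Num.norm /= mx_normrE.
  by apply/bigmax_geP; right => /=; exists (ord0, i).
apply: MK; last exact: subset_closure.
by rewrite (le_lt_trans (ler_norm _))// ltrDl.
Qed.

Lemma bounded_off_compact (K : set 'rV[R]_N) (v : 'rV[R]_N -> R) : compact K ->
  continuous v -> (forall x, ~ K x -> v x = 0) ->
  exists2 B : R, 0 <= B & forall x, `|v x| <= B.
Proof.
move=> cK cv v0.
have [B [_ BK]] := compact_bounded (continuous_compact (continuous_subspaceT cv) cK).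
exists (`|B| + 1); first by rewrite addr_ge0.
move=> x; have [Kx|/v0 ->] := pselect (K x); last by rewrite normr0 addr_ge0.
apply: BK; last by exists x.
by rewrite (le_lt_trans (ler_norm _))// ltrDl.
Qed.

Lemma Cc_infty_bounded : exists2 B : R, 0 <= B & forall x, `|u x| <= B.
Proof.
apply: (bounded_off_compact Ccu.2 Cc_infty_continuous) => x nKx.
by apply: contrapT => /eqP ux; apply: nKx; exact: subset_closure.
Qed.

(** The complement of the support is open, so [u] is locally [0] there and its derivative vanishes;
    on the compact support, continuity gives the bound. *)
Lemma Cc_infty_partial_bounded i :
  exists2 B : R, 0 <= B & forall x, `|'D_(delta_mx ord0 i) u x| <= B.
Proof.
apply: (bounded_off_compact Ccu.2); first by have [] := Ccu.1 [:: i].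
move=> x nKx.
rewrite (@near_eq_derive R _ _ u (cst 0)) ?derive_cst//.
have oC : open (~` closure [set x | u x != 0]) by exact/closed_openC/closed_closure.
have := open_nbhs_nbhs (conj oC nKx).
apply: filterS => y /= nKy; apply: contrapT => /eqP uy.
by apply: nKy; exact: subset_closure.
Qed.

(** The displacement [z] is performed one coordinate at a time. By the mean value theorem each move
    costs at most [B i] times the size of that coordinate, which is at most the norm; hence the
    constant [\sum_i B i]. *)
Lemma Cc_infty_lipschitz : exists2 L : R, 0 <= L &
  forall x z, `|u (x + z) - u x| <= L * enorm z.
Proof.
have /choice[B Bu] : forall i, exists B : R, 0 <= B /\
    forall x, `|'D_(delta_mx ord0 i) u x| <= B.
  by move=> i; have [B B0 Bu] := Cc_infty_partial_bounded i; exists B.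
have step1 i x t : `|u (x + t *: delta_mx ord0 i) - u x| <= B i * `|t|.
  pose g (s : R) := u (x + s *: delta_mx ord0 i).
  have dg (s : R) : is_derive s 1 g ('D_(delta_mx ord0 i) u (x + s *: delta_mx ord0 i)).
    apply/is_derive_line; apply: derivableP.
    by have [_ ] := Ccu.1 [::]; apply.
  have cg (A : set R) : {within A, continuous g}.
    apply: continuous_subspaceT => s; apply: differentiable_continuous.
    by apply/derivable1_diffP; exact: (@ex_derive _ _ _ _ _ _ _ (dg s)).
  have g0 : u x = g 0 by rewrite /g scale0r addr0.
  rewrite -/(g t) g0.
  have [t0|t0|->] := ltgtP t 0; last by rewrite subrr normr0 mulr0.
    have [c _ E] := MVT t0 (fun y _ => dg y) (cg _).
    by rewrite distrC E normrM sub0r normrN ler_wpM2r// (Bu i).2.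
  have [c _ E] := MVT t0 (fun y _ => dg y) (cg _).
  by rewrite E normrM subr0 ler_wpM2r// (Bu i).2.
have steps (z : 'rV[R]_N) (s : seq 'I_N) x :
    `|u (x + \sum_(i <- s) z ord0 i *: delta_mx ord0 i) - u x| <=
    \sum_(i <- s) B i * `|z ord0 i|.
  elim: s x => [|i s IH] x; first by rewrite !big_nil addr0 subrr normr0.
  rewrite !big_cons addrA; set y := x + _.
  rewrite -(subrK (u y) (u _)) -addrA.
  apply: le_trans (ler_normD _ _) _; rewrite [leRHS]addrC lerD//.
  exact: step1.
exists (\sum_i B i); first by apply: sumr_ge0 => i _; exact: (Bu i).1.
move=> x z; rewrite {1}(row_sum_delta z).
apply: le_trans (steps z _ x) _; rewrite mulr_suml ler_sum// => i _.
by rewrite ler_wpM2l ?(Bu i).1// coord_le_enorm.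
Qed.

End Cc_infty_theory.

End smooth_rV.

(** * Energy estimates *)

Section translation_modulus.
Context {R : realType} {N : nat}.
Local Notation mu := (lebesgue_rV R N).
Variable (p : R).
Hypothesis p1 : 1 <= p.

Let p0 : 0 < p. Proof. exact: lt_le_trans ltr01 p1. Qed.

Local Open Scope ereal_scope.

(** This is the function [D] of the introductory comment. *)
Definition translation_modulus (u : 'rV[R]_N -> R) (z : 'rV[R]_N) : \bar R :=
  \int[mu]_x (`|u (x + z) - u x| `^ p)%:E.

(** The [p]-th power of the norm, not the norm itself. *)
Definition pnorm (u : 'rV[R]_N -> R) : \bar R := \int[mu]_x (`|u x| `^ p)%:E.

Lemma measurable_powR_norm d (T : measurableType d) (f : T -> R) :
  measurable_fun setT f -> measurable_fun setT (fun x => (`|f x| `^ p)%R).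
Proof.
move=> mf; apply: (measurableT_comp (measurable_powR p)).
exact: (measurableT_comp (@normr_measurable R setT)).
Qed.

Section measurable_u.
Variable u : 'rV[R]_N -> R.
Hypothesis mu_u : measurable_fun setT u.

Lemma measurable_increment :
  measurable_fun setT
    (fun zx : 'rV[R]_N * 'rV[R]_N => `|u (zx.2 + zx.1) - u zx.2| `^ p)%R.
Proof.
apply: measurable_powR_norm; apply: measurable_funB.
  apply: (measurableT_comp mu_u).
  have := measurableT_comp (@measurable_rV_add R N) (measurable_fun_pair
    (@measurable_snd _ _ ('rV[R]_N) ('rV[R]_N))
    (@measurable_fst _ _ ('rV[R]_N) ('rV[R]_N))).
  exact.
exact: (measurableT_comp mu_u measurable_snd).
Qed.

Lemma measurable_increment_at (z : 'rV[R]_N) :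
  measurable_fun setT (fun x : 'rV[R]_N => `|u (x + z) - u x| `^ p)%R.
Proof.
apply: measurable_powR_norm; apply: measurable_funB => //.
exact: (measurableT_comp mu_u (measurable_rV_addr z)).
Qed.

Lemma translation_modulus_ge0 z : 0 <= translation_modulus u z.
Proof. by apply: integral_ge0 => x _; rewrite lee_fin powR_ge0. Qed.

Lemma measurable_translation_modulus :
  measurable_fun setT (translation_modulus u).
Proof.
apply: (@measurable_fun_fubini_tonelli_F _ _ _ _ R mu
  (fun zx : 'rV[R]_N * 'rV[R]_N => (`|u (zx.2 + zx.1) - u zx.2| `^ p)%:E)).
  by apply/measurable_EFinP; exact: measurable_increment.
by move=> zx; rewrite lee_fin powR_ge0.
Qed.

Lemma pnorm_ge0 : 0 <= pnorm u.
Proof. by apply: integral_ge0 => x _; rewrite lee_fin powR_ge0. Qed.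

Section borel_kernel.
Variable k : 'rV[R]_N -> R.
Hypotheses (mk : measurable_fun setT k) (k0 : forall z, (0 <= k z)%R).

Let mEk D : measurable_fun D (fun z => (k z)%:E).
Proof. by apply: measurable_funTS; exact/measurable_EFinP. Qed.

Lemma energy_insideE r : energy_inside p k u r =
  \int[mu]_(z in [set z | (enorm z < r)%R]) ((k z)%:E * translation_modulus u z).
Proof.
apply: eq_integral => z _.
rewrite -ge0_integralZl//.
- by apply/measurable_EFinP; exact: measurable_increment_at.
- by rewrite lee_fin.
Qed.

(* Substitute y = x + z in the inner integral, then exchange the order of
   integration. *)
Lemma energyE : energy p k u =
  \int[mu]_z ((k z)%:E * translation_modulus u z).
Proof.
pose f (xy : 'rV[R]_N * 'rV[R]_N) : \bar R :=
  (k (xy.2 - xy.1) * `|u xy.1 - u xy.2| `^ p)%:E.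
have mf : measurable_fun setT f.
  apply/measurable_EFinP; apply: measurable_funM.
    exact: (measurableT_comp mk (@measurable_rV_sub R N)).
  apply: measurable_powR_norm; apply: measurable_funB.
    exact: (measurableT_comp mu_u measurable_fst).
  exact: (measurableT_comp mu_u measurable_snd).
have f0 xy : 0 <= f xy by rewrite lee_fin mulr_ge0// powR_ge0.
pose g (zx : 'rV[R]_N * 'rV[R]_N) : \bar R :=
  (k zx.1 * `|u (zx.2 + zx.1) - u zx.2| `^ p)%:E.
have mg : measurable_fun setT g.
  apply/measurable_EFinP; apply: measurable_funM; last exact: measurable_increment.
  exact: (measurableT_comp mk measurable_fst).
have g0 zx : 0 <= g zx by rewrite lee_fin mulr_ge0// powR_ge0.
rewrite /energy (fubini_tonelli1 f mf f0).
transitivity (\int[mu]_x \int[mu]_z g (z, x)).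
  apply: eq_integral => x _; rewrite /fubini_F.
  have mfx : measurable_fun setT (fun y => f (x, y)).
    exact: (measurableT_comp mf (measurable_pair1 x)).
  have T := @ge0_integral_translate R N x (fun y => f (x, y)) mfx (fun y => f0 _).
  apply: (etrans (esym T)).
  by apply: eq_integral => z _; rewrite /f /g /= addrK distrC [(z + x)%R]addrC.
rewrite -(fubini_tonelli g mg g0); apply: eq_integral => z _.
rewrite -ge0_integralZl//.
- by apply/measurable_EFinP; exact: measurable_increment_at.
- by rewrite lee_fin.
Qed.

Let mkD : measurable_fun setT (fun z => (k z)%:E * translation_modulus u z).
Proof. by apply: emeasurable_funM => //; exact: measurable_translation_modulus. Qed.

Let kD_ge0 z : 0 <= (k z)%:E * translation_modulus u z.
Proof. by rewrite mule_ge0// ?lee_fin// translation_modulus_ge0. Qed.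


Let mmom : measurable_fun setT (fun z => (enorm z `^ p * k z)%:E).
Proof.
apply/measurable_EFinP; apply: measurable_funM => //.
exact: (measurableT_comp (measurable_powR p) (@measurable_enorm R N)).
Qed.

Let mom_ge0 z : 0 <= (enorm z `^ p * k z)%:E.
Proof. by rewrite lee_fin mulr_ge0// powR_ge0. Qed.

Lemma borel_moment_inside_mono r r' : (r <= r')%R ->
  moment_inside p k r <= moment_inside p k r'.
Proof.
move=> rr; apply: ge0_subset_integral => //.
  exact: measurable_funTS.
by move=> z /= zr; exact: lt_le_trans rr.
Qed.

(* On the shell r < |z| <= r' one has 1 <= r^-p |z|^p. *)
Lemma borel_mass_outside_le r r' : (0 < r)%R -> 
  mass_outside k r <= mass_outside k r' + (r `^ p)^-1%:E * moment_inside p k (r' + 1).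
Proof.
move=> r0.
set A := [set z : 'rV[R]_N | (r' < enorm z)%R].
set S := [set z : 'rV[R]_N | (r < enorm z)%R] `\` A.
have mS : measurable S by exact: measurableD.
have k0' z : 0 <= (k z)%:E by rewrite lee_fin.
apply: (@le_trans _ _ (\int[mu]_(z in A `|` S) (k z)%:E)).
  apply: ge0_subset_integral => //; first exact: measurableU.
  by move=> z zr; have [Az|nAz] := pselect (A z); [left|right].
rewrite ge0_integral_setU//; last first.
  by apply/disj_setPS => z [Az [_ /(_ Az)]].
rewrite leeD2l//.
apply: (@le_trans _ _ (\int[mu]_(z in S) ((r `^ p)^-1%:E * (enorm z `^ p * k z)%:E))).
  apply: ge0_le_integral => //.
  - by apply: measurable_funTS; apply: emeasurable_funM.
  - move=> z [/= rz _]; rewrite -EFinM lee_fin mulrA ler_peMl//.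
    rewrite mulrC ler_pdivlMr ?powR_gt0// mul1r.
    by apply: ge0_ler_powR; rewrite ?nnegrE ?enorm_ge0 ?ltW.
rewrite ge0_integralZl//.
- rewrite lee_wpmul2l ?lee_fin ?invr_ge0 ?powR_ge0//.
  apply: ge0_subset_integral => //; first exact: measurable_funTS.
  move=> z [_ /= /negP]; rewrite -leNgt => zr.
  by rewrite (le_lt_trans zr)// ltrDl.
- exact: measurable_funTS.
- by rewrite lee_fin invr_ge0 powR_ge0.
Qed.

Lemma borel_energy_inside_le (C : R) : (0 <= C)%R ->
  (forall z, translation_modulus u z <= (C * enorm z `^ p)%:E) ->
  forall r, energy_inside p k u r <= C%:E * moment_inside p k r.
Proof.
move=> C0 uC r; rewrite energy_insideE -ge0_integralZl//; last exact: measurable_funTS.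
apply: ge0_le_integral => //.
- exact: measurable_funTS.
- by apply: measurable_funTS; apply: emeasurable_funM.
- move=> z _; apply: (@le_trans _ _ ((k z)%:E * (C * enorm z `^ p)%:E)).
    by rewrite lee_wpmul2l ?lee_fin.
  by rewrite -!EFinM lee_fin mulrCA [(k z * _)%R]mulrC.
Qed.

(** Outside the ball of radius [r0] the integrand of the energy is exactly [c] times the kernel. The
    rest is an integral over the closed ball, which the open ball of radius [r0 + 1] contains. *)
Lemma borel_energy_bounds (r0 : R) (c : \bar R) : 0 <= c ->
  (forall z, (r0 < enorm z)%R -> translation_modulus u z = c) ->
  c * mass_outside k r0 <= energy p k u <=
  c * mass_outside k r0 + energy_inside p k u (r0 + 1).
Proof.
move=> c0 uc; rewrite energyE.
set A := [set z : 'rV[R]_N | (r0 < enorm z)%R].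
have mAC : measurable (~` A) by exact: measurableC.
have EA : c * mass_outside k r0 =
    \int[mu]_(z in A) ((k z)%:E * translation_modulus u z).
  rewrite /mass_outside -ge0_integralZl//.
    by apply: eq_integral => z; rewrite inE => Az; rewrite uc// muleC.
  by move=> z _; rewrite lee_fin.
rewrite EA -{1 2}(setUv A) ge0_integral_setU//=; last 2 first.
- exact: measurable_funTS.
- by apply/disj_setPS => z [Az /(_ Az)].
rewrite leeDl ?integral_ge0//= leeD2l//.
rewrite energy_insideE; apply: ge0_subset_integral => //.
  exact: measurable_funTS.
move=> z /= /negP; rewrite -leNgt => zr.
by rewrite (le_lt_trans zr)// ltrDl.
Qed.

End borel_kernel.
End measurable_u.
End translation_modulus.

(** * Bounds on the translation modulus of test functions *)

Section test_functions.
Context {R : realType} {N : nat}.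
Local Notation mu := (lebesgue_rV R N).
Variable (p : R).
Hypothesis p1 : 1 <= p.

Let p0 : 0 < p. Proof. exact: lt_le_trans ltr01 p1. Qed.

Local Open Scope ereal_scope.

Let cube (M : R) : set 'rV[R]_N := box (const_mx (- M)%R) (const_mx M).

Let cubeP M x : cube M x <-> forall i, (`|x ord0 i| <= M)%R.
Proof.
by split=> xM i; have := xM i; rewrite ?mxE in_itv /= ler_norml.
Qed.

Let mu_cube M : (0 <= M)%R -> mu (cube M) = ((M + M) ^+ N)%:E.
Proof. by move=> M0; rewrite lebesgue_rV_box ?opprK// ge0_cp. Qed.

Lemma integral_cube_cst M (c : R) : (0 <= M)%R -> (0 <= c)%R ->
  \int[mu]_x (c * \1_(cube M) x)%:E = (c * (M + M) ^+ N)%:E.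
Proof.
move=> M0 c0; have mM : measurable (cube M) by exact: measurable_box.
under eq_integral do rewrite EFinM.
rewrite ge0_integralZl//; last by apply/measurable_EFinP; exact: measurable_indic.
rewrite EFinM -(mu_cube M0); congr (_ * _).
by rewrite integral_indic// setIT.
Qed.

Lemma enorm_gt_coord (M : R) (z : 'rV[R]_N) : (0 <= M)%R ->
  (Num.sqrt N%:R * M < enorm z)%R -> exists i, (M < `|z ord0 i|)%R.
Proof.
move=> M0 zM; apply: contrapT => nex; move: zM; apply/negP; rewrite -leNgt.
apply: enorm_le_coord => // i; rewrite leNgt; apply/negP => Mi; apply: nex.
by exists i.
Qed.

Section smooth_compactly_supported.
Variable u : 'rV[R]_N -> R.
Hypothesis Ccu : Cc_infty u.
Let mu_u := Cc_infty_measurable Ccu.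

Lemma Cc_infty_pnorm_lty : pnorm p u < +oo.
Proof.
have [M M0 uM] := Cc_infty_support Ccu.
have [B B0 uB] := Cc_infty_bounded Ccu.
have mM : measurable (cube M) by exact: measurable_box.
apply: (@le_lt_trans _ _ (\int[mu]_x (B `^ p * \1_(cube M) x)%:E)).
  apply: ge0_le_integral => //.
  - by apply/measurable_EFinP; exact: measurable_powR_norm.
  - by apply/measurable_EFinP; apply: measurable_funM => //; exact: measurable_indic.
  - move=> x _; rewrite lee_fin indicE.
    have [ux|ux] := eqVneq (u x) 0%R.
      by rewrite ux normr0 powR0 ?gt_eqF// mulr_ge0 ?powR_ge0.
    rewrite mem_set ?mulr1; last exact/cubeP/uM.
    by apply: ge0_ler_powR; rewrite ?nnegrE ?(ltW p0).
by rewrite integral_cube_cst ?ltry ?powR_ge0 ?(ltW M0).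
Qed.

Lemma Cc_infty_LnormE : 'N[mu]_p%:E[EFin \o u] `^ p = pnorm p u.
Proof.
by rewrite poweR_Lnorm ?gt_eqF//; apply: eq_integral => x _.
Qed.

Lemma Cc_infty_Lfun : u \in Lfun mu p%:E.
Proof.
rewrite inE; apply/andP; split; rewrite inE//=.
rewrite /finite_norm ltey; apply/negP => /eqP Ny.
have := Cc_infty_pnorm_lty; rewrite -Cc_infty_LnormE Ny poweRyr ?gt_eqF//.
Qed.

(** An increment is at most [L * enorm z], and is nonzero only if [x] or [x + z] lies in a cube
    carrying the support. Each of these two sets of [x] has volume [V], hence the factor [V + V]. *)
Lemma Cc_infty_translation_modulus_le : exists2 C : R, (0 <= C)%R &
  forall z, translation_modulus p u z <= (C * enorm z `^ p)%:E.
Proof.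
have [M M0 uM] := Cc_infty_support Ccu.
have [L L0 uL] := Cc_infty_lipschitz Ccu.
have mM : measurable (cube M) by exact: measurable_box.
set V := ((M + M) ^+ N)%R.
exists (L `^ p * (V + V))%R.
  by rewrite mulr_ge0 ?powR_ge0// addr_ge0// exprn_ge0// addr_ge0// ltW.
move=> z; set c := ((L * enorm z) `^ p)%R.
have c0 : (0 <= c)%R by exact: powR_ge0.
pose h x : \bar R := (c * \1_(cube M) x)%:E.
have mh : measurable_fun setT h.
  by apply/measurable_EFinP; apply: measurable_funM => //; exact: measurable_indic.
have h0 x : 0 <= h x by rewrite lee_fin mulr_ge0// indicE.
have mhz : measurable_fun setT (fun x : 'rV[R]_N => h (x + z)%R).
  exact: (measurableT_comp mh (measurable_rV_addr z)).
apply: (@le_trans _ _ (\int[mu]_x (h x + h (x + z)%R))).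
  apply: ge0_le_integral => //.
  - by apply/measurable_EFinP; exact: measurable_increment_at.
  - exact: emeasurable_funD.
  - move=> x _; rewrite /h -EFinD lee_fin -mulrDr.
    have [E|ux] := eqVneq (u (x + z) - u x)%R 0%R.
      by rewrite E normr0 powR0 ?gt_eqF// mulr_ge0// addr_ge0// indicE.
    have I1 : (1 <= \1_(cube M) x + \1_(cube M) (x + z) :> R)%R.
      have [uxz|uxz] := eqVneq (u (x + z)%R) 0%R; last first.
        by rewrite [X in (_ + X)%R]indicE mem_set ?lerDr ?indicE//; exact/cubeP/uM.
      rewrite indicE mem_set ?lerDl ?indicE//; apply/cubeP/uM.
      by move: ux; rewrite uxz sub0r oppr_eq0.
    apply: (@le_trans _ _ c); last by rewrite ler_peMr.
    by apply: ge0_ler_powR; rewrite ?nnegrE ?mulr_ge0 ?enorm_ge0 ?(ltW p0).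
rewrite ge0_integralD// (ge0_integral_translate z mh h0) integral_cube_cst ?(ltW M0)//.
rewrite -EFinD lee_fin -mulrDr /c powRM ?enorm_ge0//.
by rewrite mulrAC.
Qed.

(* When |z| exceeds the diameter of the support, the supports of u and of its
   translate are disjoint. *)
Lemma Cc_infty_translation_modulus_far : exists2 r0 : R, (0 < r0)%R &
  forall z, (r0 < enorm z)%R -> translation_modulus p u z = 2%:E * pnorm p u.
Proof.
have [M M0 uM] := Cc_infty_support Ccu.
(* Beyond [sqrt N * (M + M)] some coordinate of [z] exceeds the width [M + M] of the support; adding
   [1] keeps the radius positive when [N = 0]. *)
exists (Num.sqrt N%:R * (M + M) + 1)%R.
  by rewrite ltr_wpDl// mulr_ge0 ?sqrtr_ge0// addr_ge0// ltW.
move=> z zM.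
have [i Mi] : exists i, (M + M < `|z ord0 i|)%R.
  by apply: enorm_gt_coord; [rewrite addr_ge0// ltW|rewrite (lt_trans _ zM)// ltrDl].
pose h x : \bar R := (`|u x| `^ p)%:E.
have mh : measurable_fun setT h.
  by apply/measurable_EFinP; exact: measurable_powR_norm.
have h0 x : 0 <= h x by rewrite lee_fin powR_ge0.
have mhz : measurable_fun setT (fun x : 'rV[R]_N => h (x + z)%R).
  exact: (measurableT_comp mh (measurable_rV_addr z)).
transitivity (\int[mu]_x (h x + h (x + z)%R)).
  apply: eq_integral => x _; rewrite /h -EFinD; congr EFin.
  have [ux|ux] := eqVneq (u x) 0%R.
    by rewrite ux subr0 normr0 powR0 ?gt_eqF// add0r.
  have [uxz|uxz] := eqVneq (u (x + z)%R) 0%R.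
    by rewrite uxz sub0r normrN normr0 powR0 ?gt_eqF// addr0.
  exfalso; have := uM _ ux i; have := uM _ uxz i; rewrite mxE => a b.
  move: Mi; apply/negP; rewrite -leNgt -(addrK (x ord0 i) (z ord0 i)).
  by rewrite (le_trans (ler_normB _ _))// lerD// addrC.
rewrite ge0_integralD// (ge0_integral_translate z mh h0) -/(pnorm p u).
by rewrite -mule2n -mule_natl.
Qed.

End smooth_compactly_supported.

Lemma Cc_infty_bump a : Cc_infty (@smooth_bump R N a).
Proof.
rewrite -[smooth_bump a]mul1r; apply: Cc_infty_bump_mul => n.
exact: (@Ck_cst _ _ _ _ n 1%R).
Qed.

(** The bump is [1] on a cube of positive volume. This permits division by its norm when the mass is
    recovered from the limit of the energies. *)
Lemma pnorm_bump_gt0 a : (0 < a)%R -> 0 < pnorm p (@smooth_bump R N a).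
Proof.
move=> a0; have mM : measurable (cube a) by exact: measurable_box.
apply: (@lt_le_trans _ _ (\int[mu]_x (1 * \1_(cube a) x)%:E)).
  by rewrite integral_cube_cst ?(ltW a0)// mul1r lte_fin exprn_gt0// addr_gt0.
apply: ge0_le_integral => //.
- by apply/measurable_EFinP; apply: measurable_funM => //; exact: measurable_indic.
- apply/measurable_EFinP; apply: measurable_powR_norm.
  by apply: Cc_infty_measurable; exact: Cc_infty_bump.
- move=> x _; rewrite lee_fin mul1r indicE.
  have [xa|nxa] := pselect (cube a x); last by rewrite memNset ?powR_ge0.
  by rewrite mem_set// bump_eq1 ?normr1 ?powR1//; exact/cubeP.
Qed.

Definition coord_bump (a : R) (i : 'I_N) : 'rV[R]_N -> R :=
  fun x => (x ord0 i * smooth_bump a x)%R.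

Lemma Cc_infty_coord_bump a i : Cc_infty (coord_bump a i).
Proof.
apply: (@Cc_infty_bump_mul R N a (fun x => x ord0 i)) => n.
by apply: (@Ck_coord R N n id i); exact: Ck_id.
Qed.

(* On the unit cube, u (x + z) - u x = z_i as long as |z| < r. *)
Lemma coord_bump_translation_modulus_ge r i z : (enorm z < r)%R ->
  (`|z ord0 i| `^ p)%:E <= translation_modulus p (coord_bump (r + 1) i) z.
Proof.
move=> zr.
have r0 : (0 < r)%R by rewrite (le_lt_trans _ zr)// enorm_ge0.
have mM : measurable (cube 1) by exact: measurable_box.
apply: (@le_trans _ _ (\int[mu]_x (`|z ord0 i| `^ p * \1_(cube 1) x)%:E)).
  (* The volume of [cube 1] is [2 ^ N], hence at least [1]. *)
  rewrite integral_cube_cst ?powR_ge0// lee_fin ler_peMr ?powR_ge0// exprn_ege1//.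
  by rewrite lerDl.
apply: ge0_le_integral => //.
- by apply/measurable_EFinP; apply: measurable_funM => //; exact: measurable_indic.
- apply/measurable_EFinP; apply: measurable_increment_at.
  by apply: Cc_infty_measurable; exact: Cc_infty_coord_bump.
- move=> x _; rewrite lee_fin indicE.
  have [x1|nx1] := pselect (cube 1 x); last by rewrite memNset// mulr0 powR_ge0.
  rewrite mem_set// mulr1 /coord_bump.
  (* The coordinates of [x] and of [x + z] are at most [r + 1] in absolute value, which explains the
     size of the bump. *)
  rewrite !bump_eq1 ?mulr1 ?mxE; last 2 first.
  + move=> j; rewrite (le_trans ((cubeP _ _).1 x1 j))// lerDr ltW//.
  + move=> j; rewrite mxE (le_trans (ler_normD _ _))// addrC lerD//.
      by rewrite (le_trans (coord_le_enorm _ _))// ltW.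
    exact: (cubeP _ _).1 x1 j.
  by rewrite [(_ + z _ _)%R]addrC addrK.
Qed.

(** One test function per coordinate: [enorm_powR_le] splits the moment into powers of coordinates,
    and the modulus of the corresponding [coord_bump] dominates each of them. *)
Lemma borel_moment_inside_le (k : 'rV[R]_N -> R) r : measurable_fun setT k ->
  (forall z, 0 <= k z)%R ->
  moment_inside p k r <= (Num.sqrt N%:R `^ p)%:E *
    \sum_(i < N) energy_inside p k (coord_bump (r + 1) i) r.
Proof.
move=> mk k0.
have mc i := Cc_infty_measurable (Cc_infty_coord_bump (r + 1) i).
pose f i z := (k z)%:E * translation_modulus p (coord_bump (r + 1) i) z.
have f0 i z : 0 <= f i z by rewrite mule_ge0 ?lee_fin// translation_modulus_ge0.
have mf i : measurable_fun setT (f i).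
  apply: emeasurable_funM; first exact/measurable_EFinP.
  exact: measurable_translation_modulus.
have msum : measurable_fun [set z | enorm z < r]%R (fun z => \sum_(i < N) f i z).
  by apply: measurable_funTS; exact: emeasurable_sum.
have -> : \sum_(i < N) energy_inside p k (coord_bump (r + 1) i) r =
    \int[mu]_(z in [set z | enorm z < r]%R) (\sum_(i < N) f i z).
  rewrite (@ge0_integral_sum _ _ _ mu _ _ _ f) //.
    by apply: eq_bigr => i _; exact: energy_insideE.
  by move=> i; apply: measurable_funTS.
rewrite -ge0_integralZl//; last by move=> z _; exact: sume_ge0.
apply: ge0_le_integral => //.
- by move=> z _; rewrite lee_fin mulr_ge0// powR_ge0.
- apply: measurable_funTS; apply/measurable_EFinP; apply: measurable_funM => //.
  exact: (measurableT_comp (measurable_powR p) (@measurable_enorm R N)).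
- exact: emeasurable_funM.
move=> z zr; rewrite mulrC.
apply: (@le_trans _ _ ((Num.sqrt N%:R `^ p)%:E *
    ((k z)%:E * (\sum_(i < N) `|z ord0 i| `^ p)%:E))).
  rewrite -!EFinM lee_fin mulrCA ler_wpM2l//.
  exact: enorm_powR_le.
rewrite lee_wpmul2l ?lee_fin ?powR_ge0// /f -ge0_sume_distrr; last first.
  by move=> i _; rewrite translation_modulus_ge0.
rewrite lee_wpmul2l ?lee_fin// -sumEFin lee_sum// => i _.
exact: coord_bump_translation_modulus_ge.
Qed.

End test_functions.

(** * Transfer of the estimates to Lebesgue measurable kernels *)

Section lebesgue_measurable_kernels.
Context {R : realType} {N : nat}.
Local Notation mu := (lebesgue_rV R N).
Variable (p : R).
Hypothesis p1 : 1 <= p.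
Local Open Scope ereal_scope.

(** The section of the set at each [x] is a translate of [Z], hence null. *)
Lemma product_null_difference (Z : set 'rV[R]_N) : measurable Z -> mu Z = 0 ->
  (mu \x mu) [set xy | Z (xy.2 - xy.1)%R] = 0.
Proof.
move=> mZ Z0; rewrite /product_measure1; apply: integral0_eq => x _ /=.
rewrite -Z0 -(@lebesgue_rV_translate R N (- x)%R Z mZ); congr (_ _).
by apply/seteqP; split=> y; rewrite xsectionE /=; rewrite ?inE.
Qed.

(** One Borel representative serves all four integrals. For the energy, a double integral, the
    exceptional set is that of the pairs whose difference lies in [Z]. *)
Lemma kernel_borel (k : 'rV[R]_N -> R) : lebesgue_measurable_fun k ->
  (forall z, 0 <= k z)%R ->
  exists k' : 'rV[R]_N -> R,
    [/\ measurable_fun setT k' /\ (forall z, 0 <= k' z)%R,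
        forall r, mass_outside k r = mass_outside k' r,
        forall r, moment_inside p k r = moment_inside p k' r,
        forall u, energy p k u = energy p k' u &
        forall u r, energy_inside p k u r = energy_inside p k' u r].
Proof.
move=> mk k0; have [k' [Z [mk' k'0 mZ Z0 kk']]] := lebesgue_measurable_borel mk k0.
have mZ' : measurable [set xy : 'rV[R]_N * 'rV[R]_N | Z (xy.2 - xy.1)%R].
  by have := @measurable_rV_sub R N measurableT Z mZ; rewrite setTI.
exists k'; split; first by split.
- move=> r; apply: (ge0_eq_integral_off_null _ mZ Z0) => z; rewrite ?lee_fin//.
  by move=> /kk' ->.
- move=> r; apply: (ge0_eq_integral_off_null _ mZ Z0) => z.
  + by rewrite lee_fin mulr_ge0 ?powR_ge0.
  + by rewrite lee_fin mulr_ge0 ?powR_ge0.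
  + by move=> /kk' ->.
- move=> u; rewrite /energy; apply: (ge0_eq_integral_off_null _ mZ').
  + exact: product_null_difference.
  + by move=> xy; rewrite lee_fin mulr_ge0 ?powR_ge0.
  + by move=> xy; rewrite lee_fin mulr_ge0 ?powR_ge0.
  + by move=> xy /= /kk' ->.
- move=> u r; apply: (ge0_eq_integral_off_null _ mZ Z0) => z.
  + by apply: integral_ge0 => x _; rewrite lee_fin mulr_ge0 ?powR_ge0.
  + by apply: integral_ge0 => x _; rewrite lee_fin mulr_ge0 ?powR_ge0.
  + by move=> /kk' E; apply: eq_integral => x _; rewrite E.
Qed.

Section kernel.
Variable k : 'rV[R]_N -> R.
Hypotheses (mk : lebesgue_measurable_fun k) (k0 : forall z, (0 <= k z)%R).

Lemma moment_inside_ge0 r : 0 <= moment_inside p k r.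
Proof. by apply: integral_ge0 => z _; rewrite lee_fin mulr_ge0 ?powR_ge0. Qed.

Lemma energy_inside_ge0 u r : 0 <= energy_inside p k u r.
Proof.
apply: integral_ge0 => z _; apply: integral_ge0 => x _.
by rewrite lee_fin mulr_ge0 ?powR_ge0.
Qed.

Lemma moment_inside_mono r r' : (r <= r')%R ->
  moment_inside p k r <= moment_inside p k r'.
Proof.
have [k' [[mk' k'0] _ E _ _]] := kernel_borel mk k0; rewrite !E.
exact: borel_moment_inside_mono.
Qed.

Lemma mass_outside_le r r' : (0 < r)%R ->
  mass_outside k r <=
  mass_outside k r' + (r `^ p)^-1%:E * moment_inside p k (r' + 1).
Proof.
have [k' [[mk' k'0] E1 E2 _ _]] := kernel_borel mk k0; rewrite !E1 E2.
exact: borel_mass_outside_le.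
Qed.

End kernel.

(** [C] is chosen before the kernel, so the estimate is uniform over all the [rho e]. *)
Lemma energy_inside_le (u : 'rV[R]_N -> R) : Cc_infty u -> exists2 C : R, (0 <= C)%R &
  forall (k : 'rV[R]_N -> R) r, lebesgue_measurable_fun k -> (forall z, 0 <= k z)%R ->
    energy_inside p k u r <= C%:E * moment_inside p k r.
Proof.
move=> Ccu; have [C C0 uC] := Cc_infty_translation_modulus_le p1 Ccu.
exists C => // k r mk k0.
have [k' [[mk' k'0] _ E1 _ E2]] := kernel_borel mk k0; rewrite E1 E2.
by apply: borel_energy_inside_le => //; exact: Cc_infty_measurable.
Qed.

(** Here too [r0] precedes the kernel: one radius serves along the whole limit. *)
Lemma energy_bounds (u : 'rV[R]_N -> R) : Cc_infty u -> exists2 r0 : R, (0 < r0)%R &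
  forall k : 'rV[R]_N -> R, lebesgue_measurable_fun k -> (forall z, 0 <= k z)%R ->
    2%:E * pnorm p u * mass_outside k r0 <= energy p k u <=
    2%:E * pnorm p u * mass_outside k r0 + energy_inside p k u (r0 + 1).
Proof.
move=> Ccu; have [r0 r00 ufar] := Cc_infty_translation_modulus_far p1 Ccu.
exists r0 => // k mk k0.
have [k' [[mk' k'0] E1 _ E2 E3]] := kernel_borel mk k0; rewrite E1 E2 E3.
apply: borel_energy_bounds => //; first exact: Cc_infty_measurable.
by rewrite mule_ge0// pnorm_ge0.
Qed.

Lemma moment_inside_le (k : 'rV[R]_N -> R) r : lebesgue_measurable_fun k ->
  (forall z, 0 <= k z)%R ->
  moment_inside p k r <= (Num.sqrt N%:R `^ p)%:E *
    \sum_(i < N) energy_inside p k (coord_bump (r + 1) i) r.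
Proof.
move=> mk k0; have [k' [[mk' k'0] _ E1 _ E2]] := kernel_borel mk k0.
rewrite E1; under eq_bigr do rewrite E2.
exact: borel_moment_inside_le.
Qed.

End lebesgue_measurable_kernels.

(** * Passage to the limit and the implications between the conditions *)

Section limits.
Context {R : realType} {N : nat}.
Variables (p : R) (rho : R -> 'rV[R]_N -> R).
Hypotheses (p1 : 1 <= p)
  (mrho : forall e, 0 < e -> lebesgue_measurable_fun (rho e))
  (rho0 : forall e, 0 < e -> forall z, 0 <= rho e z).
Local Open Scope ereal_scope.

Let near_pos : \forall e \near (0%R : R)^'+, (0 < e)%R.
Proof. exact: nbhs_right_gt. Qed.

Let cvg0Zl (c : R) (f : R -> \bar R) : f e @[e --> (0:R)^'+] --> 0 ->
  c%:E * f e @[e --> (0:R)^'+] --> 0.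
Proof.
by move=> f0; rewrite -(mule0 c%:E); apply: cvgeZl.
Qed.

Let squeeze0 (f g : R -> \bar R) : (forall e, (0 < e)%R -> 0 <= f e <= g e) ->
  g e @[e --> (0:R)^'+] --> 0 -> f e @[e --> (0:R)^'+] --> 0.
Proof.
move=> fg g0; apply: (squeeze_cvge _ (cvg_cst _) g0).
by near=> e; apply: fg; near: e.
Unshelve. all: by end_near. Qed.

Let cvg_near_lty (T : Type) (F : set_system T) (f : T -> \bar R) l : Filter F ->
  f x @[x --> F] --> l -> l < +oo -> \forall x \near F, f x < +oo.
Proof.
move=> FF fl ly; apply: (fl [set y | y < +oo]); apply: open_nbhs_nbhs.
by split => //; exact: open_ereal_lt_ereal.
Qed.

(** [mass_outside_le] is applied from [r] to [r1] and from [r1] to [r]: the error terms on both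
    sides are multiples of moments, which vanish in the limit. *)
Lemma mass_outside_cvg r r1 l : (0 < r)%R -> (0 < r1)%R -> l \is a fin_num ->
  (forall r, (0 < r)%R -> moment_inside p (rho e) r @[e --> 0^'+] --> 0) ->
  mass_outside (rho e) r1 @[e --> 0^'+] --> l ->
  mass_outside (rho e) r @[e --> 0^'+] --> l.
Proof.
move=> r0 r10 lfin m0 Ml.
have c1 : (r1 `^ p)^-1%:E * moment_inside p (rho e) (r + 1) @[e --> 0^'+] --> 0.
  by apply: cvg0Zl; apply: m0; rewrite addr_gt0.
have c2 : (r `^ p)^-1%:E * moment_inside p (rho e) (r1 + 1) @[e --> 0^'+] --> 0.
  by apply: cvg0Zl; apply: m0; rewrite addr_gt0.
have lo : mass_outside (rho e) r1 - (r1 `^ p)^-1%:E * moment_inside p (rho e) (r + 1)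
    @[e --> 0^'+] --> l.
  by rewrite -[X in _ --> X]sube0; apply: cvgeB => //; rewrite fin_num_adde_defl.
have hi : mass_outside (rho e) r1 + (r `^ p)^-1%:E * moment_inside p (rho e) (r1 + 1)
    @[e --> 0^'+] --> l.
  by rewrite -[X in _ --> X]adde0; apply: cvgeD => //; rewrite fin_num_adde_defl.
apply: (squeeze_cvge _ lo hi).
(* The moment must be finite before it can be moved to the other side of an inequality in
   [\bar R]. *)
have c1lt : \forall e \near (0 : R)^'+,
    (r1 `^ p)^-1%:E * moment_inside p (rho e) (r + 1) < +oo.
  exact: cvg_near_lty c1 (ltry 0%R).
near=> e; have e0 : (0 < e)%R by near: e.
apply/andP; split; last by apply: mass_outside_le => //; [exact: mrho|exact: rho0].
rewrite leeBlDr; first by apply: mass_outside_le => //; [exact: mrho|exact: rho0].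
rewrite ge0_fin_numE; first by near: e.
by rewrite mule_ge0 ?lee_fin ?invr_ge0 ?powR_ge0// moment_inside_ge0//; exact: rho0.
Unshelve. all: by end_near. Qed.

Lemma uniform_iterated : uniform_moment_conditions p rho ->
  iterated_limits_conditions p rho.
Proof.
move=> unif; split.
- exists (cst 1); split; last exact: cvg_cst.
  by exists 0%R; split; [exact: num_real|move=> r /unif[]].
- exists (cst 0); split; last exact: cvg_cst.
  by exists 0%R; split; [exact: num_real|move=> r /unif[]].
Qed.

Lemma iterated_uniform : iterated_limits_conditions p rho ->
  uniform_moment_conditions p rho.
Proof.
move=> [[g [Mg g1]] [h [mh h0]]].
have m0 r : (0 < r)%R -> moment_inside p (rho e) r @[e --> 0^'+] --> 0.
  move=> r0.
  (* The inner limit may be unknown at [r] itself, so a larger radius [s] where it exists is used,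
     and monotonicity goes back to [r]. *)
  have [s rs ms] := pinfty_ex_gt (num_real r) mh.
  have hs_ge0 : 0 <= h s.
    apply: (cvge_ge _ ms); near=> e.
    by apply: moment_inside_ge0; apply: rho0; near: e.
  (* Inner limits inherit monotonicity in the radius: [h s <= h t] for large [t], while [h t] tends
     to [0]. *)
  have hs0 : h s = 0.
    apply/eqP; rewrite eq_le hs_ge0 andbT.
    apply: (cvge_ge _ h0); near=> t.
    have mt : moment_inside p (rho e) t @[e --> 0^'+] --> h t by near: t.
    have st : (s <= t)%R by near: t; apply: nbhs_pinfty_ge; exact: num_real.
    apply: (lee_cvg_to ms mt).
    near=> e; have e0 : (0 < e)%R by near: e.
    by apply: moment_inside_mono => //; [exact: mrho|exact: rho0].
  rewrite hs0 in ms; apply: squeeze0 ms => e e0.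
  rewrite moment_inside_ge0/=; last exact: rho0.
  by apply: moment_inside_mono (ltW rs); [exact: mrho|exact: rho0].
have Hg : \forall r' \near +oo%R, [/\ (0 < r')%R, g r' \is a fin_num &
    mass_outside (rho e) r' @[e --> 0^'+] --> g r'].
  have [gfin _] := (fine_cvgP _ _).1 g1.
  near=> r'; split; near: r' => //.
  by apply: nbhs_pinfty_gt; exact: num_real.
have [r1 _ [r10 gfin M1]] := pinfty_ex_gt (num_real 0%R) Hg.
(* As the radius is irrelevant, [g] equals [g r1] at all large radii, so its limit [1] is [g r1]. *)
have gr1 : g r1 = 1.
  apply: cvg_unique g1; first exact: ereal_hausdorff.
  apply: cvg_near_cst; apply: filterS Hg => r' [r'0 _ M'].
  apply: cvg_unique M' _; first exact: ereal_hausdorff.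
  exact: (mass_outside_cvg (r1 := r1)).
move=> r r0; split; last exact: m0.
by rewrite gr1 in M1 gfin; exact: (mass_outside_cvg (r1 := r1)).
Unshelve. all: by end_near. Qed.

Lemma uniform_mazya_shaposhnikova : uniform_moment_conditions p rho ->
  mazya_shaposhnikova p rho.
Proof.
move=> unif u Ccu.
have p0 : (0 < p)%R by rewrite (lt_le_trans ltr01).
have [C C0 uC] := energy_inside_le p1 Ccu.
have [r0 r00 ub] := energy_bounds p1 Ccu.
have inside0 r : (0 < r)%R -> energy_inside p (rho e) u r @[e --> 0^'+] --> 0.
  move=> rpos; apply: (@squeeze0 _ (fun e => C%:E * moment_inside p (rho e) r)).
    move=> e e0.
    by rewrite energy_inside_ge0 ?uC//=; [exact: mrho|exact: rho0|exact: rho0].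
  by apply: cvg0Zl; exact: (unif r rpos).2.
have Ifin : pnorm p u \is a fin_num.
  by rewrite ge0_fin_numE ?pnorm_ge0// Cc_infty_pnorm_lty.
have lim_energy : energy p (rho e) u @[e --> 0^'+] --> 2%:E * pnorm p u.
  have lo : 2%:E * pnorm p u * mass_outside (rho e) r0 @[e --> 0^'+] --> 2%:E * pnorm p u.
    rewrite -[X in _ --> X]mule1; apply: cvgeZl; first by rewrite fin_numM.
    exact: (unif r0 r00).1.
  have hi : 2%:E * pnorm p u * mass_outside (rho e) r0 + energy_inside p (rho e) u (r0 + 1)
      @[e --> 0^'+] --> 2%:E * pnorm p u.
    have i0 := inside0 _ (addr_gt0 r00 ltr01).
    have := cvgeD (fin_num_adde_defl _ (isT : 0 \is a fin_num)) lo i0.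
    by rewrite adde0; apply.
  apply: (squeeze_cvge _ lo hi); near=> e; have e0 : (0 < e)%R by near: e.
  by apply: ub; [exact: mrho|exact: rho0].
split; [|by rewrite Cc_infty_LnormE|exact: inside0].
(* The energies have a finite limit, hence are finite for small [e]. *)
near=> e; split; first exact: Cc_infty_Lfun.
near: e; apply: cvg_near_lty lim_energy _.
by rewrite -ge0_fin_numE ?fin_numM// mule_ge0 ?pnorm_ge0.
Unshelve. all: by end_near. Qed.

Lemma mazya_shaposhnikova_uniform : mazya_shaposhnikova p rho ->
  uniform_moment_conditions p rho.
Proof.
move=> MS.
have p0 : (0 < p)%R by rewrite (lt_le_trans ltr01).
have m0 r : (0 < r)%R -> moment_inside p (rho e) r @[e --> 0^'+] --> 0.
  move=> rpos.
  apply: (@squeeze0 _ (fun e => (Num.sqrt N%:R `^ p)%:E *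
    \sum_(i < N) energy_inside p (rho e) (coord_bump (r + 1) i) r)).
    move=> e e0; rewrite moment_inside_ge0/=; last exact: rho0.
    by apply: moment_inside_le => //; [exact: mrho|exact: rho0].
  apply: cvg0Zl; elim: (index_enum _) => [|i s IH].
    by under eq_fun do rewrite big_nil; exact: cvg_cst.
  under eq_fun do rewrite big_cons.
  have [_ _ /(_ r rpos) Ei] := MS _ (Cc_infty_coord_bump (r + 1) i).
  have := cvgeD (fin_num_adde_defl _ (isT : 0 \is a fin_num)) Ei IH.
  by rewrite adde0; apply.
(* For the mass, the formula is applied to this single nonzero test function. *)
have Ccu := @Cc_infty_bump R N 1.
have [r0 r00 ub] := energy_bounds p1 Ccu.
have [_ Elim inside0] := MS _ Ccu.
rewrite Cc_infty_LnormE// in Elim.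
set I := pnorm p _ in Elim ub.
have Ifin : I \is a fin_num.
  by rewrite ge0_fin_numE ?pnorm_ge0// Cc_infty_pnorm_lty.
have I0 : 0 < I by exact: pnorm_bump_gt0.
have inside1 : energy_inside p (rho e) (smooth_bump 1) (r0 + 1) @[e --> 0^'+] --> 0.
  by apply: inside0; rewrite addr_gt0.
(* By [energy_bounds], this quantity lies between the energy minus its inside part and the energy,
   which have the same limit. *)
have Ml : 2%:E * I * mass_outside (rho e) r0 @[e --> 0^'+] --> 2%:E * I.
  have lo : energy p (rho e) (smooth_bump 1) - energy_inside p (rho e) (smooth_bump 1) (r0 + 1)
      @[e --> 0^'+] --> 2%:E * I.
    rewrite -[X in _ --> X]sube0; apply: cvgeB => //.
    by rewrite fin_num_adde_defl.
  apply: (squeeze_cvge _ lo Elim).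
  have insfin : \forall e \near (0 : R)^'+,
      energy_inside p (rho e) (smooth_bump 1) (r0 + 1) < +oo.
    exact: cvg_near_lty inside1 (ltry 0%R).
  near=> e; have e0 : (0 < e)%R by near: e.
  have /andP[ub1 ub2] := ub _ (mrho e0) (rho0 e0).
  rewrite ub1 andbT leeBlDr// ge0_fin_numE; first by near: e.
  by apply: energy_inside_ge0; exact: rho0.
(* The factor [2 * I] is finite and positive, so it can be cancelled. *)
have M1 : mass_outside (rho e) r0 @[e --> 0^'+] --> 1.
  pose c := fine (2%:E * I).
  have cE : c%:E = 2%:E * I by rewrite fineK// fin_numM.
  have c0 : (0 < c)%R by rewrite -lte_fin cE mule_gt0.
  rewrite -cE in Ml.
  have := cvgeZl (isT : (c^-1)%:E \is a fin_num) Ml.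
  rewrite -EFinM mulVf ?gt_eqF//.
  apply: cvg_trans; apply: near_eq_cvg; near=> e.
  by rewrite muleA -EFinM mulVf ?gt_eqF// mul1e.
move=> r rpos; split; last exact: m0.
exact: (mass_outside_cvg (r1 := r0)).
Unshelve. all: by end_near. Qed.

End limits.

Theorem theorem2p1 (R : realType) (N : nat) (p : R)
    (rho : R -> 'rV[R]_N -> R) :
  1 <= p ->
  (forall e, 0 < e -> lebesgue_measurable_fun (rho e)) ->
  (forall e, 0 < e -> forall z, 0 <= rho e z) ->
  (uniform_moment_conditions p rho <-> iterated_limits_conditions p rho) /\
  (iterated_limits_conditions p rho <-> mazya_shaposhnikova p rho).
Proof.
(* Every implication passes through the uniform moment conditions. *)
move=> p1 mrho rho0; split; split.
- exact: uniform_iterated.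
- exact: iterated_uniform.
- by move=> /(iterated_uniform p1 mrho rho0); exact: uniform_mazya_shaposhnikova.
- by move=> /(mazya_shaposhnikova_uniform p1 mrho rho0); exact: uniform_iterated.
Qed.
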